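(* Let $W:\mathbb{R}^d\to\mathbb{R}$ be such that $W\in C^1(\mathbb{R}^d)$; $W(-z)=W(z)$ for all $z\in\mathbb{R}^d$; $z\mapsto W(z)+\frac{L}{2}|z|^2$ is convex for some $L\ge 0$; and $\sup_{z\in\mathbb{R}^d}\frac{|DW(z)|}{1+|z|}<\infty$. Let $f_0\in\mathcal{P}(\mathbb{R}^d\times\mathbb{R}^d)$ satisfy $\int_{\mathbb{R}^d\times\mathbb{R}^d}(|x|^2+|v|^2)\,df_0<\infty$. Let $(f^k)_{k\in\mathbb{N}}$ be an approximating sequence of particle solutions for $f_0$ (defined in the context). Suppose that $f:[0,\infty)\to\mathcal{P}(\mathbb{R}^d\times\mathbb{R}^d)$, $t\mapsto f_t$, and a subsequence $(f^{k_j})_{j\in\mathbb{N}}$ are such that $f^{k_j}_t\to f_t$ narrowly in $\mathcal{P}(\mathbb{R}^d\times\mathbb{R}^d)$ uniformly for $t$ in compact subintervals of $[0,\infty)$, and $$\lim_{j\to\infty}\int_{\mathbb{R}^d\times\mathbb{R}^d}\varphi\,df^{k_j}_t=\int_{\mathbb{R}^d\times\mathbb{R}^d}\varphi\,df_t$$ for each $t\ge0$ and each continuous $\varphi:\mathbb{R}^d\times\mathbb{R}^d\to\mathbb{R}$ with $\sup_{x,v\in\mathbb{R}^d}\frac{|\varphi(x,v)|}{1+|x|+|v|}<\infty$. Then $f$ is a weak solution of the Jeans-Vlasov equation $$\partial_t f+v\cdot D_xf-DW*\rho\cdot D_vf=0$$ which satisfies the initial condition $f|_{t=0}=f_0$.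
   Context: $\mathcal{P}(X)$ is the set of Borel probability measures on a complete separable metric space $X$. Narrow convergence $\mu_k\to\mu$ means $\int g\,d\mu_k\to\int g\,d\mu$ for all bounded continuous $g$. The narrow topology is metrized by a metric of the form $\mathcal{d}(\mu,\nu)=\sum_{j\ge1}2^{-j}\left|\int h_j\,d\mu-\int h_j\,d\nu\right|$ for suitable fixed functions $h_j$ with $\|h_j\|_\infty\le1$ and $\mathrm{Lip}(h_j)\le1$; uniform convergence in $t$ is understood with respect to this metric. Weak solution: for $f_0\in\mathcal{P}(\mathbb{R}^d\times\mathbb{R}^d)$, a weak solution of the Jeans-Vlasov equation with $f|_{t=0}=f_0$ is a narrowly continuous map $f:[0,\infty)\to\mathcal{P}(\mathbb{R}^d\times\mathbb{R}^d)$, $t\mapsto f_t$, satisfying $$\int_0^\infty\int_{\mathbb{R}^d\times\mathbb{R}^d}\left(\partial_t\phi+v\cdot D_x\phi-DW*\rho_t\cdot D_v\phi\right)df_t\,dt+\int_{\mathbb{R}^d\times\mathbb{R}^d}\phi|_{t=0}\,df_0=0$$ for each $\phi\in C^1_c(\mathbb{R}^d\times\mathbb{R}^d\times[0,\infty))$, where $\rho_t\in\mathcal{P}(\mathbb{R}^d)$ is given by $\rho_t(B)=f_t(B\times\mathbb{R}^d)$ for Borel $B\subset\mathbb{R}^d$, and $(DW*\rho_t)(x)=\int_{\mathbb{R}^d}DW(x-y)\,d\rho_t(y)$. Approximating sequence of particle solutions for $f_0$: choose $f^k_0\in\mathcal{P}(\mathbb{R}^d\times\mathbb{R}^d)$,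 each of the form $f_0^k=\sum_{i=1}^Nm_i\delta_{(x_i,v_i)}$ with $m_i>0$, $\sum_{i=1}^Nm_i=1$ (where $N,m_i,x_i,v_i$ may depend on $k$), such that $f^k_0\to f_0$ narrowly and $\int(|x|^2+|v|^2)\,df^k_0\to\int(|x|^2+|v|^2)\,df_0$. For each $k$ put $f^k_t=\sum_{i=1}^Nm_i\delta_{(\gamma_i(t),\dot\gamma_i(t))}$, $t\ge0$, where $\gamma_1,\dots,\gamma_N\in C^2([0,\infty);\mathbb{R}^d)$ is a solution of $m_i\ddot\gamma_i(t)=-\sum_{j=1}^Nm_im_jDW(\gamma_i(t)-\gamma_j(t))$, $t>0$, with $\gamma_i(0)=x_i$, $\dot\gamma_i(0)=v_i$ (such a solution exists under the hypotheses on $W$). *)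

(* Defs.v *)
From HB Require Import structures.
From mathcomp Require Import all_boot all_order all_algebra.
From mathcomp Require Import all_classical all_reals all_analysis.

Set Implicit Arguments.
Unset Strict Implicit.
Unset Printing Implicit Defensive.

Import Order.TTheory GRing.Theory Num.Theory.
Import numFieldNormedType.Exports.

Local Open Scope classical_set_scope.
Local Open Scope ring_scope.

(* The library norm on 'rV[R]_d is the sup norm; it is used only for topology
   and differentiability.  Every quantitative |x| is the Euclidean norm. *)
Definition dot {R : realType} {d : nat} (x y : 'rV[R]_d) : R :=
  \sum_(i < d) x ord0 i * y ord0 i.

Definition enorm {R : realType} {d : nat} (x : 'rV[R]_d) : R :=
  Num.sqrt (dot x x).

Definition grad {R : realType} {d : nat} (g : 'rV[R]_d -> R) (x : 'rV[R]_d) :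
  'rV[R]_d := \row_(i < d) 'D_(delta_mx ord0 i) g x.

Definition C1 {R : realType} {d : nat} (g : 'rV[R]_d -> R) : Prop :=
  (forall x, differentiable g x) /\ continuous (grad g).

(* Functions on [0, +oo) are encoded as functions on R whose values at negative
   arguments are never used: derivatives are taken within [0, +oo), hence are
   one-sided at 0 and the usual ones at t > 0. *)
Definition hquot {R : realType} {V : normedModType R} (g : R -> V) (t : R) :=
  (fun s : R => (s - t)^-1 *: (g s - g t)) @
    within [set s : R | 0 <= s] t^'.

Definition hderivable {R : realType} {V : normedModType R} (g : R -> V)
  (t : R) : Prop := cvg (hquot g t).

Definition hderive {R : realType} {V : normedModType R} (g : R -> V)
  (t : R) : V := lim (hquot g t).

Definition C2_halfline {R : realType} {V : normedModType R} (g : R -> V) :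
    Prop :=
  [/\ forall t, 0 <= t -> hderivable g t,
      forall t, 0 <= t -> hderivable (hderive g) t &
      {within [set t : R | 0 <= t], continuous (hderive (hderive g))}].

Notation phase R d := ('rV[R]_d * 'rV[R]_d)%type (only parsing).

Notation borel T := (g_sigma_algebraType (@open T)).

Notation Pborel R T := (probability (borel T) R).

Definition bounded_continuous {R : realType} {T : topologicalType}
  (g : T -> R) : Prop :=
  continuous g /\ exists M : R, forall z, `|g z| <= M.

Section Narrow.
Context {R : realType} {T : normedModType R}.

Definition narrow_cvg (mu : nat -> Pborel R T) (nu : Pborel R T) : Prop :=
  forall g : T -> R, bounded_continuous g ->
    \int[mu k]_z g z @[k --> \oo] --> \int[nu]_z g z.

(* The coarsest topology for which mu |-> \int g dmu is continuous for every
   bounded continuous g. *)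
Definition narrow_eval (mu : Pborel R T) :
    prod_topology (fun _ : set_type (@bounded_continuous R T) => R) :=
  fun g => \int[mu]_z set_val g z.

Definition narrow_space := initial_topology narrow_eval.

(* The index is shifted: h j is the (j+1)-st function of the family. *)
Definition narrow_dist (h : nat -> T -> R) (mu nu : Pborel R T) : R :=
  limn (series (fun j : nat =>
    2^-1 ^+ j.+1 * `|\int[mu]_z h j z - \int[nu]_z h j z|)).

Definition metrizes_narrow (h : nat -> T -> R) : Prop :=
  forall mu : narrow_space,
    nbhs mu =
    filter_from [set e : R | 0 < e]
      (fun e => [set nu : narrow_space | narrow_dist h mu nu < e]).

End Narrow.
Arguments narrow_space : clear implicits.

Definition admissible_narrow_family {R : realType} {d : nat}
    (h : nat -> phase R d -> R) : Prop :=
  [/\ forall j z, `|h j z| <= 1,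
      forall j (z w : phase R d),
        `|h j z - h j w| <=
          Num.sqrt (enorm (z.1 - w.1) ^+ 2 + enorm (z.2 - w.2) ^+ 2) &
      metrizes_narrow h].

Section JeansVlasov.
Context {R : realType} {d : nat}.

Lemma measurable_fst_borel :
  measurable_fun [set: borel (phase R d)]
    (fst : borel (phase R d) -> borel 'rV[R]_d).
Proof.
apply: (@measurability _ _ (borel (phase R d)) (borel 'rV[R]_d) setT _
  (@open 'rV[R]_d)) => //.
move=> _ [B oB <-]; rewrite setTI; apply: sub_sigma_algebra.
by apply: open_comp => // z _; exact: cvg_fst.
Qed.

HB.instance Definition _ := isMeasurableFun.Build _ _ (borel (phase R d))
  (borel 'rV[R]_d) (fst : borel (phase R d) -> borel 'rV[R]_d)
  measurable_fst_borel.

Definition spatial_marginal (mu : Pborel R (phase R d)) :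
    Pborel R 'rV[R]_d :=
  distribution mu (fst : borel (phase R d) -> borel 'rV[R]_d).

Definition force (W : 'rV[R]_d -> R) (rho : Pborel R 'rV[R]_d)
    (x : 'rV[R]_d) : 'rV[R]_d :=
  \row_(i < d) \int[rho]_y grad W (x - y) ord0 i.

(* Test functions have arguments (x, v, t). *)
Definition Dx (phi : phase R d * R -> R) (p : phase R d * R) : 'rV[R]_d :=
  grad (fun x => phi (x, p.1.2, p.2)) p.1.1.

Definition Dv (phi : phase R d * R -> R) (p : phase R d * R) : 'rV[R]_d :=
  grad (fun v => phi (p.1.1, v, p.2)) p.1.2.

Definition Dt (phi : phase R d * R -> R) (p : phase R d * R) : R :=
  hderive (fun s => phi (p.1, s)) p.2.

Definition test_function (phi : phase R d * R -> R) : Prop :=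
  let H := [set p : phase R d * R | 0 <= p.2] in
  [/\ forall x v t, 0 <= t ->
        [/\ differentiable (fun y => phi (y, v, t)) x,
            differentiable (fun w => phi (x, w, t)) v &
            hderivable (fun s => phi (x, v, s)) t],
      [/\ {within H, continuous (Dx phi)},
          {within H, continuous (Dv phi)} &
          {within H, continuous (Dt phi)}] &
      compact (closure [set p | H p /\ phi p != 0])].

Definition transport (W : 'rV[R]_d -> R) (f : R -> Pborel R (phase R d))
    (phi : phase R d * R -> R) (t : R) (z : phase R d) : R :=
  Dt phi (z, t) + dot z.2 (Dx phi (z, t))
  - dot (force W (spatial_marginal (f t)) z.1) (Dv phi (z, t)).

(* The library integral is total, so the integrability of the three integrands
   occurring in the weak formulation is required explicitly. *)
Definition weak_solution (W : 'rV[R]_d -> R) (f0 : Pborel R (phase R d))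
    (f : R -> Pborel R (phase R d)) : Prop :=
  [/\ {within [set t : R | 0 <= t],
         continuous (f : R -> narrow_space R (phase R d))},
      forall t, 0 <= t -> forall x i,
        (spatial_marginal (f t)).-integrable setT
          (fun y => (grad W (x - y) ord0 i)%:E) &
      forall phi, test_function phi ->
        [/\ forall t, 0 <= t ->
              (f t).-integrable setT (EFin \o transport W f phi t),
            lebesgue_measure.-integrable `[0, +oo[
              (fun t => (\int[f t]_z transport W f phi t z)%:E) &
            \int[lebesgue_measure]_(t in `[0, +oo[)
               (\int[f t]_z transport W f phi t z)
            + \int[f0]_z phi (z, 0) = 0]].

(* Measures are compared on Borel sets only: the underlying set functions are
   unspecified elsewhere. *)
Definition eq_borel (mu nu : Pborel R (phase R d)) : Prop :=
  forall A : set (borel (phase R d)), measurable A -> mu A = nu A.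

Definition is_particle_measure (N : nat) (m : 'I_N -> R)
    (x v : 'I_N -> 'rV[R]_d) (mu : Pborel R (phase R d)) : Prop :=
  forall A : set (borel (phase R d)), measurable A ->
    mu A = (\sum_(i < N) (m i)%:E * \d_((x i, v i) : borel (phase R d)) A)%E.

Definition newton_solution (W : 'rV[R]_d -> R) (N : nat) (m : 'I_N -> R)
    (x v : 'I_N -> 'rV[R]_d) (gamma : 'I_N -> R -> 'rV[R]_d) : Prop :=
  [/\ forall i, C2_halfline (gamma i),
      forall i t, 0 < t ->
        m i *: hderive (hderive (gamma i)) t =
        - \sum_(j < N) (m i * m j) *: grad W (gamma i t - gamma j t),
      forall i, gamma i 0 = x i &
      forall i, hderive (gamma i) 0 = v i].

Definition moment2 (mu : Pborel R (phase R d)) : \bar R :=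
  (\int[mu]_z (enorm z.1 ^+ 2 + enorm z.2 ^+ 2)%:E)%E.

Definition approximating_sequence (W : 'rV[R]_d -> R)
    (f0 : Pborel R (phase R d)) (f : nat -> R -> Pborel R (phase R d)) :
    Prop :=
  exists f0k : nat -> Pborel R (phase R d),
    [/\ narrow_cvg f0k f0,
        moment2 (f0k k) @[k --> \oo] --> moment2 f0 &
        forall k, exists (N : nat) (m : 'I_N -> R)
            (x v : 'I_N -> 'rV[R]_d) (gamma : 'I_N -> R -> 'rV[R]_d),
          [/\ forall i, 0 < m i,
              \sum_(i < N) m i = 1,
              is_particle_measure m x v (f0k k),
              newton_solution W m x v gamma &
              forall t, 0 <= t ->
                is_particle_measure m (fun i => gamma i t)
                  (fun i => hderive (gamma i) t) (f k t)]].

Definition cvg_locally_uniformly (h : nat -> phase R d -> R)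
    (fj : nat -> R -> Pborel R (phase R d)) (f : R -> Pborel R (phase R d)) :
    Prop :=
  forall a b : R, 0 <= a -> a <= b -> forall e : R, 0 < e ->
    \forall j \near \oo, forall t, t \in `[a, b] ->
      narrow_dist h (fj j t) (f t) < e.

End JeansVlasov.

(* Main.v *)
Require Import Defs.
From HB Require Import structures.
From mathcomp Require Import all_boot all_order all_algebra.
From mathcomp Require Import all_classical all_reals all_analysis.
From mathcomp Require Import measurable_realfun.
From mathcomp Require Import ring lra.

Set Implicit Arguments.
Unset Strict Implicit.
Unset Printing Implicit Defensive.

Import Order.TTheory GRing.Theory Num.Theory.
Import numFieldNormedType.Exports.

Local Open Scope classical_set_scope.
Local Open Scope ring_scope.

(** The trajectories of a particle solution obey Newton's law, so the chain rule
    and the fundamental theorem of calculus along each of them give the weak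
    formulation for the particle measures.  Gronwall's inequality applied to
    [sum_i m_i (|gamma_i|^2 + |gamma_i'|^2)] bounds their second moments, locally
    uniformly in time and uniformly in [k].  This bound makes the forces
    [DW * rho^k_t] equicontinuous in [x]; they converge pointwise because [DW] has
    linear growth, hence locally uniformly, and the product
    [(DW * rho^k_t) . D_v phi] passes to the limit although it depends on the
    measure twice.  Dominated convergence in [t] then yields the weak formulation
    for [f]. *)

(** * Euclidean and sup norms *)

(** Only integrals of functions of linear growth pass to the limit, whereas the uniform bound is on
    second moments. The gap between the two exponents carries the argument: an error
    [e * (1 + |y|^2)] in the kernel absorbs tails of linear size, and the limit force inherits its
    modulus of continuity from the approximants, not from a second moment of [f t]. The compact
    support of a test function confines the force to bounded [x] and the drift [v . D_x phi] to
    bounded [v], so at each time the integrands are bounded by a constant times one plus a first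
    moment. Two norms coexist: the hypotheses are Euclidean, topology and differentiability use the
    sup norm, and the factors [d%:R] come from comparing them. *)

Lemma cvg_sumr (R : numFieldType) (V : normedModType R) (T I : Type)
    (F : set_system T) {FF : Filter F} (s : seq I) (f : I -> T -> V) (l : I -> V) :
  (forall i, f i x @[x --> F] --> l i) ->
  \sum_(i <- s) f i x @[x --> F] --> \sum_(i <- s) l i.
Proof.
move=> fl; apply: cvg_big => [|i _]; last exact: fl.
exact: add_continuous.
Qed.

Section Euclidean.
Context {R : realType} {d : nat}.
Implicit Types x y : 'rV[R]_d.

Lemma le_coord_norm x i : `|x ord0 i| <= `|x|.
Proof.
rewrite -[`|x|]/(mx_norm x) mx_normrE.
exact: (le_bigmax _ (fun p => `|x p.1 p.2|) (ord0, i)).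
Qed.

Lemma norm_le_coord x (r : R) : 0 <= r -> (forall i, `|x ord0 i| <= r) -> `|x| <= r.
Proof.
move=> r0 h; rewrite -[`|x|]/(mx_norm x) mx_normrE.
by apply: bigmax_le => // -[i j] _ /=; rewrite (ord1 i).
Qed.

Lemma coordB x y i : (x - y) ord0 i = x ord0 i - y ord0 i.
Proof. by rewrite !mxE. Qed.

Lemma norm_ball_compact (r : R) : compact [set x : 'rV[R]_d | `|x| <= r].
Proof.
apply: bounded_closed_compact.
  exists r; split => [|M rM x /= xr]; first exact: num_real.
  by rewrite (le_trans xr)// ltW.
have -> : [set x : 'rV[R]_d | `|x| <= r] =
  (fun x : 'rV[R]_d => `|x|) @^-1` [set y | y <= r] by [].
by apply: closed_comp (@closed_le R r) => x _; exact: norm_continuous.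
Qed.

Lemma dotC x y : dot x y = dot y x.
Proof. by apply: eq_bigr => i _; rewrite mulrC. Qed.

Lemma dotDl x y z : dot (x + y) z = dot x z + dot y z.
Proof. by rewrite -big_split; apply: eq_bigr => i _; rewrite mxE mulrDl. Qed.

Lemma dotNl x z : dot (- x) z = - dot x z.
Proof. by rewrite -sumrN; apply: eq_bigr => i _; rewrite mxE mulNr. Qed.

Lemma dotBl x y z : dot (x - y) z = dot x z - dot y z.
Proof. by rewrite dotDl dotNl. Qed.

Lemma dotZl (a : R) x z : dot (a *: x) z = a * dot x z.
Proof. by rewrite mulr_sumr; apply: eq_bigr => i _; rewrite mxE mulrA. Qed.

Lemma dotDr x y z : dot z (x + y) = dot z x + dot z y.
Proof. by rewrite !(dotC z) dotDl. Qed.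

Lemma dotNr x z : dot z (- x) = - dot z x.
Proof. by rewrite !(dotC z) dotNl. Qed.

Lemma dotBr x y z : dot z (x - y) = dot z x - dot z y.
Proof. by rewrite dotDr dotNr. Qed.

Lemma dotZr (a : R) x z : dot z (a *: x) = a * dot z x.
Proof. by rewrite !(dotC z) dotZl. Qed.

Lemma dot0l x : dot 0 x = 0.
Proof. by rewrite -[0](scale0r (0 : 'rV[R]_d)) dotZl mul0r. Qed.

Lemma dot0r x : dot x 0 = 0.
Proof. by rewrite dotC dot0l. Qed.

Lemma dot_suml (I : Type) (s : seq I) (F : I -> 'rV[R]_d) y :
  dot (\sum_(j <- s) F j) y = \sum_(j <- s) dot (F j) y.
Proof.
elim/big_ind2 : _ => [|a b a' b' <- <-|//]; first by rewrite dot0l.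
by rewrite dotDl.
Qed.

Lemma dot_ge0 x : 0 <= dot x x.
Proof. by apply: sumr_ge0 => i _; rewrite -expr2 sqr_ge0. Qed.

(** Stands in for Cauchy-Schwarz: with the sup norm each of the [d] products is bounded separately,
    which costs the factor [d]. *)
Lemma normr_dot_le x y : `|dot x y| <= d%:R * (`|x| * `|y|).
Proof.
rewrite (le_trans (ler_norm_sum _ _ _))//.
have -> : d%:R * (`|x| * `|y|) = \sum_(i < d) (`|x| * `|y|).
  by rewrite sumr_const card_ord mulr_natl.
by apply: ler_sum => i _; rewrite normrM ler_pM ?le_coord_norm.
Qed.

Lemma dot_self_le x : dot x x <= d%:R * `|x| ^+ 2.
Proof. by rewrite (le_trans (ler_norm _))// (le_trans (normr_dot_le _ _)). Qed.

Lemma norm_sqr_le_dot x : `|x| ^+ 2 <= dot x x.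
Proof.
rewrite -[leRHS]sqr_sqrtr ?dot_ge0// ler_pXn2r ?nnegrE ?sqrtr_ge0//.
apply: norm_le_coord; rewrite ?sqrtr_ge0// => i.
rewrite -sqrtr_sqr ler_wsqrtr// /dot (bigD1 i)//= expr2 lerDl.
by apply: sumr_ge0 => j _; rewrite -expr2 sqr_ge0.
Qed.

Lemma enorm_ge0 x : 0 <= enorm x. Proof. exact: sqrtr_ge0. Qed.

Lemma sqr_enorm x : enorm x ^+ 2 = dot x x.
Proof. by rewrite sqr_sqrtr ?dot_ge0. Qed.

Lemma norm_le_enorm x : `|x| <= enorm x.
Proof.
by rewrite -(@ler_pXn2r _ 2)// ?nnegrE ?enorm_ge0// sqr_enorm norm_sqr_le_dot.
Qed.

(** The sharp factor is the square root of [d]; the cruder [d] suffices, since [d <= d^2] for every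
    natural number, zero included. *)
Lemma enorm_le_norm x : enorm x <= d%:R * `|x|.
Proof.
have d0 : 0 <= d%:R * `|x| by rewrite mulr_ge0.
rewrite -(@ler_pXn2r _ 2)// ?nnegrE ?enorm_ge0//.
rewrite sqr_enorm (le_trans (dot_self_le _))// exprMn ler_wpM2r ?sqr_ge0//.
by rewrite -natrX ler_nat; case: d => // n; rewrite -mulnn leq_pmull.
Qed.

Lemma dot_young x y : 2 * dot x y <= dot x x + dot y y.
Proof.
by have := dot_ge0 (x - y); rewrite !dotBl !dotBr (dotC y x); lra.
Qed.

Lemma coord_cont (T : Type) (F : set_system T) {FF : Filter F} (f : T -> 'rV[R]_d)
    (l : 'rV[R]_d) :
  f @ F --> l -> forall i, f x ord0 i @[x --> F] --> l ord0 i.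
Proof.
move=> fl i.
apply: (@cvg_comp _ _ _ f (fun x : 'rV[R]_d => x ord0 i) F (nbhs l)) => //.
exact: coord_continuous.
Qed.

Lemma cvg_coord (T : Type) (F : set_system T) {FF : Filter F} (f : T -> 'rV[R]_d)
    (l : 'rV[R]_d) :
  (forall i, f x ord0 i @[x --> F] --> l ord0 i) -> f @ F --> l.
Proof.
move=> h; apply/cvgrPdist_le => e e0.
have : \forall x \near F, forall i, `|l ord0 i - f x ord0 i| <= e.
  by apply: filter_forall => i; move/cvgrPdist_le : (h i) => /(_ _ e0).
apply: filterS => x hx; apply: norm_le_coord; first exact: ltW.
by move=> i; rewrite coordB.
Qed.

Lemma cvg_dot (T : Type) (F : set_system T) {FF : Filter F} (f g : T -> 'rV[R]_d)
    (a b : 'rV[R]_d) :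
  f @ F --> a -> g @ F --> b ->
  dot (f x) (g x) @[x --> F] --> dot a b.
Proof.
move=> fa gb; apply: cvg_sumr => i.
by apply: cvgM; exact: coord_cont.
Qed.

End Euclidean.

(** * Borel measures on normed spaces *)

Section BorelIntegration.
Context {R : realType} {T : normedModType R}.

Lemma continuous_borel_measurable (g : T -> R) :
  continuous g -> measurable_fun [set: borel T] (g : borel T -> R).
Proof.
move=> cg; apply: (measurability _ (RGenOpens.measurableE R)).
move=> _ [_ [a [b ->] <-]]; rewrite setTI; apply: sub_sigma_algebra.
by move/continuousP : cg; apply; exact: interval_open.
Qed.

Lemma dominated_integrable (mu : {measure set (borel T) -> \bar R}) (g G : T -> R) :
  continuous g -> (forall z, `|g z| <= G z) ->
  mu.-integrable setT (EFin \o G) -> mu.-integrable setT (EFin \o g).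
Proof.
move=> cg gG; apply: le_integrable => //.
  by apply/measurable_EFinP; exact: continuous_borel_measurable.
by move=> z _ /=; rewrite lee_fin (le_trans (gG z))// ler_norm.
Qed.

Lemma integrable_scale (mu : {measure set (borel T) -> \bar R}) (c : R) (g : T -> R) :
  mu.-integrable setT (EFin \o g) -> mu.-integrable setT (EFin \o (fun z => c * g z)).
Proof.
move=> ig; have -> : EFin \o (fun z => c * g z) = (fun z => c%:E * (EFin \o g) z)%E
  by [].
exact: integrableZl.
Qed.

Lemma integrable_add (mu : {measure set (borel T) -> \bar R}) (f g : T -> R) :
  mu.-integrable setT (EFin \o f) -> mu.-integrable setT (EFin \o g) ->
  mu.-integrable setT (EFin \o (fun z => f z + g z)).
Proof.
move=> jf ig; have -> : EFin \o (fun z => f z + g z) =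
  (fun z => (EFin \o f) z + (EFin \o g) z)%E by [].
exact: integrableD.
Qed.

Lemma cst_integrable (mu : Pborel R T) (r : R) : mu.-integrable setT (fun=> r%:E).
Proof. exact: finite_measure_integrable_cst. Qed.

Lemma bounded_integrable (mu : Pborel R T) (g : T -> R) (M : R) :
  continuous g -> (forall z, `|g z| <= M) -> mu.-integrable setT (EFin \o g).
Proof.
by move=> cg gM; apply: (dominated_integrable cg gM); exact: cst_integrable.
Qed.

Lemma Rintegral_prob_cst (mu : Pborel R T) (r : R) : \int[mu]_z r = r.
Proof.
rewrite Rintegral_cst// -[RHS]mulr1; congr (_ * _).
exact: (congr1 fine (probability_setT mu)).
Qed.

Lemma normr_Rintegral_le (mu : Pborel R T) (g G : T -> R) :
  continuous g -> (forall z, `|g z| <= G z) ->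
  mu.-integrable setT (EFin \o G) -> `|\int[mu]_z g z| <= \int[mu]_z G z.
Proof.
move=> cg gG iG; have ig := dominated_integrable cg gG iG.
rewrite (le_trans (le_normr_Rintegral _ _))//; apply: le_Rintegral => //.
exact: integrable_norm.
Qed.

Lemma normr_Rintegral_bounded (mu : Pborel R T) (g : T -> R) (M : R) :
  continuous g -> (forall z, `|g z| <= M) -> `|\int[mu]_z g z| <= M.
Proof.
move=> cg gM; rewrite -[leRHS](Rintegral_prob_cst mu).
by apply: normr_Rintegral_le => //; exact: cst_integrable.
Qed.

(** * Integration against finite sums of point masses *)

Section Atomic.
Context (N : nat) (m : 'I_N -> R) (p : 'I_N -> T) (mu : Pborel R T).
Hypothesis m_gt0 : forall i, 0 < m i.
Hypothesis muE : forall A : set (borel T), measurable A ->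
  mu A = (\sum_(i < N) (m i)%:E * \d_(p i : borel T) A)%E.

Lemma ge0_integral_atomic (f : T -> \bar R) :
  measurable_fun [set: borel T] (f : borel T -> \bar R) -> (forall z, 0 <= f z)%E ->
  (\int[mu]_z f z = \sum_(i < N) (m i)%:E * f (p i))%E.
Proof.
move=> mf f0.
(* [msum] takes a family indexed by [nat], so the one indexed by ['I_N] is extended by the zero
   measure. *)
pose nu (n : nat) : {measure set (borel T) -> \bar R} :=
  if insub n is Some i then
    mscale (NngNum (ltW (m_gt0 i))) (\d_(p i : borel T)) else mzero.
rewrite (eq_measure_integral (msum nu N)); last first.
  move=> A mA _; apply: etrans (muE mA) _; rewrite /msum; apply: eq_bigr => i _.
  by rewrite /nu valK.
rewrite ge0_integral_measure_sum//; apply: eq_bigr => i _.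
by rewrite /nu valK ge0_integral_mscale// integral_dirac// diracT mul1e.
Qed.

Lemma integrable_atomic (g : T -> R) : continuous g ->
  mu.-integrable setT (EFin \o g).
Proof.
move=> cg; apply/integrableP; split.
  by apply/measurable_EFinP; exact: continuous_borel_measurable.
rewrite ge0_integral_atomic//; last first.
  apply: measurableT_comp => //; apply/measurable_EFinP.
  exact: continuous_borel_measurable.
by under eq_bigr do rewrite /= -EFinM; rewrite sumEFin ltry.
Qed.

Lemma Rintegral_atomic (g : T -> R) : continuous g ->
  \int[mu]_z g z = \sum_(i < N) m i * g (p i).
Proof.
move=> cg.
have cn : continuous (fun z => `|g z|).
  by move=> z; apply: cvg_norm; exact: cg.
have nonneg (k : T -> R) : continuous k -> (forall z, 0 <= k z) ->
    \int[mu]_z k z = \sum_(i < N) m i * k (p i).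
  move=> ck k0; rewrite /Rintegral ge0_integral_atomic//.
    by under eq_bigr do rewrite -EFinM; rewrite sumEFin.
  by apply/measurable_EFinP; exact: continuous_borel_measurable.
have cs : continuous (fun z => g z + `|g z|).
  by move=> z; apply: cvgD; [exact: cg|exact: cn].
(* Writing [g] as [(g + |g|) - |g|], a difference of nonnegative continuous functions, reduces to
   the nonnegative case. *)
transitivity (\int[mu]_z (g z + `|g z|) - \int[mu]_z `|g z|).
  rewrite -RintegralB//; last 2 first.
  - exact: integrable_atomic cs.
  - exact: integrable_atomic cn.
  by apply: eq_Rintegral => z _; rewrite addrK.
rewrite !nonneg// => [|z]; last by have := ler_norm (- g z); rewrite normrN; lra.
by rewrite -sumrB; apply: eq_bigr => i _; rewrite -mulrBr addrK.
Qed.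

End Atomic.

(** * Bounded continuous functions determine a Borel probability measure *)

Definition dist_set (A : set T) (z : T) : R := inf [set `|z - a| | a in A].

Lemma dist_set_le (A : set T) z a : A a -> dist_set A z <= `|z - a|.
Proof.
by move=> Aa; apply: ge_inf; [exists 0 => _ [b _ <-]|exists a].
Qed.

Lemma le_dist_set (A : set T) z e :
  A !=set0 -> (forall a, A a -> e <= `|z - a|) -> e <= dist_set A z.
Proof.
move=> [a Aa] h; apply: lb_le_inf; first by exists `|z - a|, a.
by move=> _ [b Ab <-]; exact: h.
Qed.

Lemma dist_set_continuous (A : set T) : A !=set0 -> continuous (dist_set A).
Proof.
move=> A0; have lip z w : dist_set A z <= `|z - w| + dist_set A w.
  rewrite -lerBlDl; apply: le_dist_set => // a Aa.
  rewrite lerBlDl (le_trans (dist_set_le z Aa))//.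
  by rewrite (le_trans _ (ler_normD _ _))// addrA subrK.
move=> z; apply/cvgrPdist_le => e e0; near=> w.
have zw : `|z - w| <= e by near: w; exact: cvgr_dist_le.
rewrite ler_norml; have := lip z w; have := lip w z.
by rewrite (distrC w z); lra.
Unshelve. all: by end_near. Qed.

(** A point of [U] has positive distance to the complement, so [n] times this distance eventually
    exceeds 1. The complement must be nonempty: the infimum of the empty set is 0 by default, and
    for [U = setT] the functions would vanish instead of being 1. *)
Lemma open_approx_indic (U : set T) : open U -> (~` U) !=set0 ->
  let g (n : nat) z := Num.min 1 (n%:R * dist_set (~` U) z) in
  [/\ forall n, continuous (g n), forall n z, `|g n z| <= 1 &
      forall z, g n z @[n --> \oo] --> (\1_U z : R)].
Proof.
move=> oU U0 g.
have dge0 z : 0 <= dist_set (~` U) z by exact: le_dist_set.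
split.
- move=> n z; apply: (@continuous_min _ _ (cst 1) (fun z => n%:R * dist_set (~` U) z)).
    exact: cvg_cst.
  by apply: cvgM; [exact: cvg_cst|exact: dist_set_continuous].
- move=> n z; rewrite ger0_norm ?ge_min ?lexx// le_min ler01/=.
  by rewrite mulr_ge0.
- move=> z; have [Uz|Uz] := pselect (U z);
  rewrite indicE ?(mem_set Uz) ?(memNset Uz)/=; last first.
    have d0 : dist_set (~` U) z = 0.
      apply/eqP; rewrite eq_le dge0 andbT.
      by rewrite (le_trans (@dist_set_le (~` U) z z _))// subrr normr0.
    by under eq_cvg do rewrite /g d0 mulr0 min_r ?ler01//; exact: cvg_cst.
  have [e e0 zeU] : exists2 e, 0 < e & forall w, `|z - w| < e -> U w.
    have /nbhs_ballP[e e0 zeU] : nbhs z U by exact: open_nbhs_nbhs.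
    by exists e => // w zw; apply: zeU; rewrite -ball_normE.
  have de : e <= dist_set (~` U) z.
    apply: le_dist_set => // a Ua; rewrite leNgt; apply/negP => /zeU; exact: Ua.
  apply: cvg_near_cst; near=> n; apply/min_idPl.
  rewrite (@le_trans _ _ (n%:R * e))//; last by rewrite ler_wpM2l.
  rewrite -ler_pdivrMr// mul1r; near: n; exact: nbhs_infty_ger.
Unshelve. all: by end_near. Qed.

(** Dominated convergence along the approximations of [\1_U] gives equality on open sets; these are
    stable under intersection and generate the Borel sets, so equality extends to all of them. *)
Lemma bounded_continuous_measure_eq (mu nu : Pborel R T) :
  (forall g : T -> R, bounded_continuous g -> \int[mu]_z g z = \int[nu]_z g z) ->
  forall A : set (borel T), measurable A -> mu A = nu A.
Proof.
move=> munu; have opens (U : set T) : open U -> mu U = nu U.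
  move=> oU; have [U0|/set0P U0] := eqVneq (~` U) set0.
    have -> : U = setT by rewrite -[U]setCK U0 setC0.
    exact: (etrans (probability_setT mu) (esym (probability_setT nu))).
  have [cg g1 gU] := open_approx_indic oU U0.
  set g := (fun (n : nat) z => Num.min 1 (n%:R * dist_set (~` U) z)) in cg g1 gU.
  have mU : measurable (U : set (borel T)) by exact: sub_sigma_algebra.
  have cvgU (P : Pborel R T) : (\int[P]_z (g n z)%:E)%E @[n --> \oo] --> P U.
    have := @dominated_convergence _ (borel T) R P setT measurableT
      (fun n z => (g n z)%:E) (fun z => (\1_U z)%:E) (fun=> 1%:E).
    case.
    - by move=> n; apply/measurable_EFinP; exact: (continuous_borel_measurable (cg n)).
    - by apply/measurable_EFinP; exact: (measurable_indic mU).
    - by apply: aeW => z _; apply: cvg_EFin; [exact: nearW|exact: gU].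
    - exact: cst_integrable.
    - by apply: aeW => z n _ /=; rewrite lee_fin g1.
    - by move=> _ _; rewrite integral_indic// setIT.
  apply: (cvg_unique _ (cvgU mu)) => //.
  have -> : (fun n => (\int[mu]_z (g n z)%:E)%E) =
            (fun n => (\int[nu]_z (g n z)%:E)%E); last exact: cvgU.
  apply/funext => n; rewrite -[LHS]fineK; last first.
    by apply: integrable_fin_num => //; exact: (bounded_integrable _ (cg n) (g1 n)).
  rewrite -[RHS]fineK; last first.
    by apply: integrable_fin_num => //; exact: (bounded_integrable _ (cg n) (g1 n)).
  by congr EFin; apply: (munu (g n)); split; [exact: cg|exists 1; exact: g1].
move=> A mA.
apply: (@g_sigma_algebra_measure_unique _ R (borel T) (@open T) _ (fun=> setT)) => //.
- by move=> U oU; exact: sub_sigma_algebra.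
- by move=> _; exact: openT.
- by rewrite bigcup_const.
- by move=> U V; exact: openI.
- by move=> _; rewrite (le_lt_trans (probability_le1 mu _))// ltry.
Qed.

End BorelIntegration.

(** * Derivatives within the half-line *)

Section HalfLine.
Context {R : realType}.

Definition halfline : set R := [set s : R | 0 <= s].

Definition punctured (t : R) : set_system R := within halfline t^'.

(** A relation, because [hderive] is a [lim] and carries information only once the quotient is known
    to converge. The rules of calculus are proved for the relation; [hderivableP] and [has_hderiveE]
    translate. *)
Definition has_hderive {V : normedModType R} (g : R -> V) (t : R) (l : V) :=
  (s - t)^-1 *: (g s - g t) @[s --> punctured t] --> l.

Lemma punctured_proper t : 0 <= t -> ProperFilter (punctured t).
Proof.
move=> t0; apply: Build_ProperFilter_ex => P.
rewrite /punctured /within/= /dnbhs /within/= => /nbhs_ballP[e /= e0 teP].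
have e20 : 0 < e / 2 by rewrite divr_gt0.
(* The point lies to the right of [t], hence in the half-line even when [t = 0]. *)
exists (t + e / 2); apply: teP.
- rewrite -ball_normE /ball_/= opprD addNKr normrN gtr0_norm//; lra.
- by apply/eqP => h; lra.
- by rewrite /halfline/=; lra.
Qed.

Lemma punctured_filter t : Filter (punctured t).
Proof. exact: within_filter. Qed.

#[local] Existing Instance punctured_filter.

Lemma hderivableP {V : normedModType R} (g : R -> V) t :
  hderivable g t -> has_hderive g t (hderive g t).
Proof. by move=> h. Qed.

Lemma has_hderiveE {V : normedModType R} (g : R -> V) t l :
  0 <= t -> has_hderive g t l -> hderive g t = l.
Proof.
by move=> t0 h; apply: cvg_lim => //; exact: punctured_proper.
Qed.

Lemma punctured_weaken t (P : set R) :
  within halfline (nbhs t) P -> punctured t P.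
Proof.
rewrite /punctured /within /dnbhs /within/= => hP.
by apply: filterS hP => s h _.
Qed.

Lemma punctured_nbhs t (P : set R) : nbhs t P -> punctured t P.
Proof.
move=> tP; apply: punctured_weaken; rewrite /within/=.
by apply: filterS tP => s h _.
Qed.

Lemma punctured_ge0 t : \forall s \near punctured t, 0 <= s.
Proof.
have : nbhs t [set s : R | s != t -> 0 <= s -> 0 <= s].
  by apply: filterE => s.
exact.
Qed.

Lemma punctured_neq t : \forall s \near punctured t, s != t.
Proof.
have : nbhs t [set s : R | s != t -> 0 <= s -> s != t].
  by apply: filterE => s.
exact.
Qed.

Lemma has_hderive_cvg {V : normedModType R} (g : R -> V) t l :
  has_hderive g t l -> g s @[s --> punctured t] --> g t.
Proof.
move=> h.
have st : s - t @[s --> punctured t] --> (0 : R).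
  have h0 : s - t @[s --> nbhs t] --> (0 : R).
    by rewrite -[X in _ --> X](subrr t); apply: cvgB => //; exact: cvg_cst.
  by move=> P /h0 hP; apply: punctured_nbhs.
rewrite -[g t]addr0 -(scale0r l).
have : g t + (s - t) *: ((s - t)^-1 *: (g s - g t)) @[s --> punctured t]
   --> g t + 0 *: l.
  by apply: cvgD; [exact: cvg_cst|exact: cvgZ].
apply: cvg_trans; apply: near_eq_cvg; near=> s.
have st0 : s - t != 0 by rewrite subr_eq0; near: s; exact: punctured_neq.
by rewrite scalerA divff// scale1r addrC subrK.
Unshelve. all: by end_near. Qed.

Lemma cvg_punctured_within {T : topologicalType} (g : R -> T) t :
  g s @[s --> punctured t] --> g t -> g s @[s --> within halfline (nbhs t)] --> g t.
Proof.
move=> h P gP; have Pt := nbhs_singleton gP.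
have h1 : nbhs t [set s : R | s != t -> 0 <= s -> P (g s)] := h P gP.
suff : nbhs t [set s : R | 0 <= s -> P (g s)] by [].
by apply: filterS h1 => s hs s0; have [->//|st] := eqVneq s t; exact: hs.
Qed.

Lemma has_hderive_continuous {V : normedModType R} (g dg : R -> V) :
  (forall t, 0 <= t -> has_hderive g t (dg t)) -> {within halfline, continuous g}.
Proof.
move=> h; apply/subspace_continuousP => t t0.
by apply: cvg_punctured_within; exact: has_hderive_cvg (h t t0).
Qed.

Lemma has_hderive_is_derive (g : R -> R) t l :
  0 < t -> has_hderive g t l -> is_derive t 1 g l.
Proof.
move=> t0 h.
have h' : h^-1 *: ((g \o shift t) (h *: (1 : R)) - g t) @[h --> 0^'] --> l.
  have sh : (h + t) @[h --> 0^'] --> punctured t.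
    move=> P; rewrite /punctured /within /dnbhs /within/=.
    move=> /nbhs_ballP[e /= e0 teP].
    (* A radius at most [t] keeps [u + t] nonnegative: away from 0 the one-sided restriction is
       invisible. *)
    apply/nbhs_ballP; exists (Num.min e t); first by rewrite /= lt_min e0.
    move=> u; rewrite -ball_normE /ball_/= sub0r normrN lt_min => /andP[ue ut] u0.
    apply: teP; first by rewrite -ball_normE /ball_/= opprD addrCA subrr addr0 normrN.
      by rewrite -subr_eq0 addrK.
    by rewrite /halfline/=; have := ler_norm (- u); rewrite normrN; lra.
  have := cvg_comp _ _ sh h; apply: cvg_trans; apply: near_eq_cvg.
  near=> u; rewrite /= addrK; congr (_ *: (g _ - _)).
  by rewrite [u *: 1]mulr1.
apply: DeriveDef; first by apply/cvg_ex; exists l.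
by apply: cvg_lim.
Unshelve. all: by end_near. Qed.

Lemma has_hderive_sum {V : normedModType R} (I : Type) (r : seq I)
    (g : I -> R -> V) t (l : I -> V) :
  (forall i, has_hderive (g i) t (l i)) ->
  has_hderive (fun s => \sum_(i <- r) g i s) t (\sum_(i <- r) l i).
Proof.
move=> h; rewrite /has_hderive.
under eq_cvg do rewrite -sumrB scaler_sumr.
exact: cvg_sumr.
Qed.

Lemma has_hderiveD {V : normedModType R} (f g : R -> V) t (k l : V) :
  has_hderive f t k -> has_hderive g t l ->
  has_hderive (fun s => f s + g s) t (k + l).
Proof.
move=> hf hg; rewrite /has_hderive.
under eq_cvg do rewrite opprD addrACA scalerDr.
exact: cvgD.
Qed.

Lemma has_hderiveZ {V : normedModType R} (g : R -> V) t (l : V) (a : R) :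
  has_hderive g t l -> has_hderive (fun s => a *: g s) t (a *: l).
Proof.
move=> h; rewrite /has_hderive.
have E s : (s - t)^-1 *: (a *: g s - a *: g t) = a *: ((s - t)^-1 *: (g s - g t)).
  by rewrite -scalerBr !scalerA mulrC.
by under eq_cvg do rewrite E; apply: cvgZ; [exact: cvg_cst|exact: h].
Qed.

Lemma has_hderive_dot {d : nat} (a b : R -> 'rV[R]_d) t (a' b' : 'rV[R]_d) :
  has_hderive a t a' -> has_hderive b t b' ->
  has_hderive (fun s => dot (a s) (b s)) t (dot a' (b t) + dot (a t) b').
Proof.
move=> ha hb; rewrite /has_hderive.
have E s : (s - t)^-1 *: (dot (a s) (b s) - dot (a t) (b t)) =
    dot ((s - t)^-1 *: (a s - a t)) (b s) + dot (a t) ((s - t)^-1 *: (b s - b t)).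
  rewrite dotZl dotZr dotBl dotBr -mulrDr; congr (_ * _); ring.
under eq_cvg do rewrite E.
apply: cvgD; apply: cvg_dot => //; first exact: has_hderive_cvg hb.
exact: cvg_cst.
Qed.

End HalfLine.

(** * Mean value theorem and chain rule for one block of variables *)

Section ChainRule.
Context {R : realType} {d : nat}.
#[local] Existing Instance punctured_filter.

Lemma diff_grad (a : 'rV[R]_d -> R) (x v : 'rV[R]_d) :
  differentiable a x -> 'd a x v = dot (grad a x) v.
Proof.
move=> da; rewrite {1}(row_sum_delta v) linear_sum /dot; apply: eq_bigr => i _.
by rewrite linearZ /= mxE deriveE// mulrC.
Qed.

Lemma mean_value_grad (a : 'rV[R]_d -> R) (x y : 'rV[R]_d) :
  (forall z, differentiable a z) ->
  exists2 th : R, th \in `[0, 1] &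
    a y - a x = dot (grad a (x + th *: (y - x))) (y - x).
Proof.
move=> da; pose l (s : R) : 'rV[R]_d := x + s *: (y - x).
have dal (s : R) : is_derive s (1 : R) (a \o l) (dot (grad a (l s)) (y - x)).
  have E : (fun h : R => h^-1 *: (((a \o l) \o shift s) (h *: (1 : R)) - (a \o l) s)) =
      (fun h : R => h^-1 *: ((a \o shift (l s)) (h *: (y - x)) - a (l s))).
    apply/funext => h /=; congr (_ *: (a _ - _)).
    by rewrite /l [h *: 1]mulr1 scalerDl addrCA addrA.
  have da' : derivable a (l s) (y - x) by exact: diff_derivable.
  rewrite -(@diff_grad a (l s) (y - x) (da (l s))) -(deriveE (y - x) (da (l s))).
  by apply: DeriveDef; rewrite /derivable /derive E.
have [] := @MVT_segment R (a \o l) (fun s => dot (grad a (l s)) (y - x)) 0 1 ler01.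
- apply: derivable_within_continuous => s _; exact: (@ex_derive _ _ _ _ _ _ _ (dal s)).
- move=> th th01; have xy : x + (y - x) = y by rewrite addrC subrK.
  rewrite /= /l scale1r scale0r addr0 xy subr0 mulr1.
  by exists th.
Qed.

(* Differentiating one block of variables at a time, by the mean value theorem,
   needs the gradient of that block only: test functions are not assumed to be
   jointly differentiable. *)
Lemma chain_rule_block (A : R -> 'rV[R]_d -> R) (x : R -> 'rV[R]_d) (t : R)
    (x' G : 'rV[R]_d) :
  (forall s, 0 <= s -> forall y, differentiable (A s) y) ->
  (forall c : R -> 'rV[R]_d, c s @[s --> punctured t] --> x t ->
     grad (A s) (c s) @[s --> punctured t] --> G) ->
  has_hderive x t x' ->
  (s - t)^-1 *: (A s (x s) - A s (x t)) @[s --> punctured t] --> dot G x'.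
Proof.
move=> dA gA hx.
(* The mean value point must be a function of [s] to define the path [c]; the sigma type selects
   one, with an arbitrary value for negative [s]. As [c s] lies between [x t] and [x s], it tends to
   [x t]. *)
have mv s : {th : R | 0 <= s -> (th \in `[0, 1]) /\
    A s (x s) - A s (x t) = dot (grad (A s) (x t + th *: (x s - x t))) (x s - x t)}.
  apply: cid; have [s0|_] := boolP (0 <= s); last by exists 0.
  by have [th] := mean_value_grad (x t) (x s) (dA s s0); exists th.
pose c s := x t + sval (mv s) *: (x s - x t).
have cx : c s @[s --> punctured t] --> x t.
  have /cvgrPdist_le hxc := has_hderive_cvg hx.
  apply/cvgrPdist_le => e /hxc he; near=> s.
  have s0 : 0 <= s by near: s; exact: punctured_ge0.
  have [/itvP th01 _] := svalP (mv s) s0.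
  rewrite /c opprD addNKr normrN normrZ ger0_norm ?th01//.
  rewrite (@le_trans _ _ `|x t - x s|)//; last by near: s.
  by rewrite distrC ler_piMl// th01.
have : dot (grad (A s) (c s)) ((s - t)^-1 *: (x s - x t)) @[s --> punctured t]
    --> dot G x' by apply: cvg_dot => //; exact: gA.
apply: cvg_trans; apply: near_eq_cvg; near=> s.
have s0 : 0 <= s by near: s; exact: punctured_ge0.
by have [_ ->] := svalP (mv s) s0; rewrite dotZr.
Unshelve. all: by end_near. Qed.

End ChainRule.

(** * Test functions *)

Section TestFunctions.
Context {R : realType} {d : nat}.
#[local] Existing Instance punctured_filter.

Lemma within_comp_cvg {U : Type} {T S : topologicalType} (F : set_system U)
    (H : set T) (P : T -> S) (Phi : U -> T) (p : T) :
  Filter F -> {within H, continuous P} -> H p ->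
  Phi u @[u --> F] --> p -> (\forall u \near F, H (Phi u)) ->
  P (Phi u) @[u --> F] --> P p.
Proof.
move=> FF /subspace_continuousP cP Hp Phip HPhi.
apply: (cvg_comp _ _ _ (cP p Hp)) => Q.
rewrite /within/= => /Phip hQ.
by apply: filterS2 hQ HPhi => u /[apply].
Qed.

Lemma grad_near0 (a : 'rV[R]_d -> R) (x : 'rV[R]_d) :
  (\forall y \near x, a y = 0) -> grad a x = 0.
Proof.
move=> h; apply/rowP => i; rewrite !mxE.
by rewrite (@near_eq_derive _ _ _ a (cst 0)) ?derive_cst.
Qed.

Lemma has_hderive_near0 (g : R -> R) (t : R) :
  g t = 0 -> (\forall s \near punctured t, g s = 0) -> has_hderive g t 0.
Proof.
move=> gt0 h; apply: cvg_near_cst; apply: filterS h => s gs.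
by rewrite gs gt0 subrr scaler0.
Qed.

Context {phi : phase R d * R -> R}.
Hypothesis phi_test : test_function phi.

Let H : set (phase R d * R) := [set p | 0 <= p.2].

Lemma test_function_support : exists2 r : R, 0 < r &
  forall x v t, 0 <= t -> r < `|x| \/ r < `|v| \/ r < t -> phi (x, v, t) = 0.
Proof.
case: phi_test => _ _ /compact_bounded[M [_ hM]].
(* [compact_bounded] supplies a bound for each number strictly above [M]; this one is also
   positive. *)
exists (`|M| + 1); first by rewrite ltr_wpDl.
move=> x v t t0 out; apply/eqP/negP => /negP h.
have : `|(x, v, t)| <= `|M| + 1.
  apply: hM; first by rewrite (le_lt_trans (ler_norm _))// ltrDl.
  by apply: subset_closure.
rewrite !prod_normE/= !ge_max (ger0_norm t0) => /andP[/andP[xr vr] tr].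
by case: out => [|[]]; rewrite ltNge ?xr ?vr ?tr.
Qed.

(** The strict inequalities are open conditions, so where one holds [phi] vanishes on a whole
    neighbourhood in the variable being differentiated. *)
Lemma test_derivatives_support : exists2 r : R, 0 < r &
  forall x v t, 0 <= t -> r < `|x| \/ r < `|v| \/ r < t ->
    [/\ Dx phi (x, v, t) = 0, Dv phi (x, v, t) = 0 & Dt phi (x, v, t) = 0].
Proof.
have [r r0 hr] := test_function_support; exists r => // x v t t0 out.
have far (z : 'rV[R]_d) : r < `|z| -> \forall y \near z, r < `|y|.
  by move=> rz; apply: (@cvgr_norm_gt _ _ _ (nbhs z) _ id z).
split.
- apply: (@grad_near0 (fun y => phi (y, v, t)) x).
  case: out => [/far h|out].
    by near=> y; apply: hr => //; left; near: y.
  by near=> y; apply: hr => //; right.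
- apply: (@grad_near0 (fun w => phi (x, w, t)) v); case: out => [out|[/far h|out]].
  + by near=> y; apply: hr => //; left.
  + by near=> y; apply: hr => //; right; left; near: y.
  + by near=> y; apply: hr => //; right; right.
- apply: has_hderiveE => //=; apply: has_hderive_near0; first exact: hr.
  have s0 := punctured_ge0 t; case: out => [out|[out|out]].
  + by apply: filterS s0 => s s0; apply: hr => //; left.
  + by apply: filterS s0 => s s0; apply: hr => //; right; left.
  + have st : \forall s \near punctured t, r < s.
      by apply: punctured_nbhs; exact: lt_nbhsr.
    by apply: filterS2 s0 st => s s0 rs; apply: hr => //; right; right.
Unshelve. all: by end_near. Qed.

(** A continuous image of a compact box is bounded. Stated for an arbitrary [P] in order to serve
    the two gradients and the time derivative alike. *)
Lemma within_support_bounded {V : normedModType R} (P : phase R d * R -> V) (r : R) :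
  {within H, continuous P} ->
  (forall x v t, 0 <= t -> r < `|x| \/ r < `|v| \/ r < t -> P (x, v, t) = 0) ->
  exists2 C : R, 0 <= C & forall z t, 0 <= t -> `|P (z, t)| <= C.
Proof.
move=> cP P0.
pose ball_r : set 'rV[R]_d := [set x | `|x| <= r].
have cb : compact ball_r by exact: norm_ball_compact.
have cB : compact ((ball_r `*` ball_r) `*` `[0, r]).
  by apply: compact_setX; [exact: compact_setX|exact: segment_compact].
have : compact (P @` ((ball_r `*` ball_r) `*` `[0, r])).
  apply: continuous_compact => //; apply: continuous_subspaceW cP.
  by move=> [z t] [_ /=]; rewrite in_itv/= => /andP[].
move=> /compact_bounded[M [_ hM]]; exists (`|M| + 1); first by rewrite addr_ge0.
move=> [x v] t t0.
have [xr|xr] := leP `|x| r; last by rewrite P0 ?normr0 ?addr_ge0//; left.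
have [vr|vr] := leP `|v| r; last by rewrite P0 ?normr0 ?addr_ge0//; right; left.
have [tr|tr] := leP t r; last by rewrite P0 ?normr0 ?addr_ge0//; right; right.
apply: hM; first by rewrite (le_lt_trans (ler_norm _))// ltrDl.
by exists (x, v, t) => //; split => //=; rewrite in_itv/= t0.
Qed.

Lemma test_derivatives_bounded : exists2 C : R, 0 <= C &
  forall z t, 0 <= t ->
    [/\ `|Dx phi (z, t)| <= C, `|Dv phi (z, t)| <= C & `|Dt phi (z, t)| <= C].
Proof.
case: phi_test => _ [cx cv ct] _; have [r r0 hr] := test_derivatives_support.
have [Cx Cx0 hx] := within_support_bounded cx
    (fun x v t t0 o => let: And3 a _ _ := hr x v t t0 o in a).
have [Cv Cv0 hv] := within_support_bounded cv
    (fun x v t t0 o => let: And3 _ a _ := hr x v t t0 o in a).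
have [Ct Ct0 ht] := within_support_bounded ct
    (fun x v t t0 o => let: And3 _ _ a := hr x v t t0 o in a).
exists (Cx + Cv + Ct) => [|z t t0]; first by rewrite !addr_ge0.
by split; [apply: le_trans (hx z t t0) _|apply: le_trans (hv z t t0) _
          |apply: le_trans (ht z t t0) _]; lra.
Qed.

(** Joint continuity of [phi] is not part of [test_function]. Moving first [x] and then [v], with
    the mean value theorem and the bounds on the gradients, shows that the initial slice is
    Lipschitz; with the support this also bounds it. *)
Lemma test_init_bounded_continuous : bounded_continuous (fun z => phi (z, 0)).
Proof.
case: phi_test => dphi _ _; have [C C0 hC] := test_derivatives_bounded.
have lip (x v x' v' : 'rV[R]_d) :
    `|phi (x, v, 0) - phi (x', v', 0)| <= d%:R * C * (`|x - x'| + `|v - v'|).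
  rewrite -(subrK (phi (x', v, 0)) (phi (x, v, 0))) -addrA mulrDr.
  rewrite (le_trans (ler_normD _ _))// lerD//.
    have [|th _ ->] := @mean_value_grad R d (fun y => phi (y, v, 0)) x' x.
      by move=> y; case: (dphi y v 0 (lexx _)).
    rewrite (le_trans (normr_dot_le _ _))// -mulrA ler_wpM2l// ler_wpM2r//.
    by have [h _ _] := hC (x' + th *: (x - x'), v) 0 (lexx _).
  have [|th _ ->] := @mean_value_grad R d (fun y => phi (x', y, 0)) v' v.
    by move=> y; case: (dphi x' y 0 (lexx _)).
  rewrite (le_trans (normr_dot_le _ _))// -mulrA ler_wpM2l// ler_wpM2r//.
  by have [_ h _] := hC (x', v' + th *: (v - v')) 0 (lexx _).
split.
  move=> [x v]; apply/cvgrPdist_le => e e0.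
  have : d%:R * C * (`|x - y.1| + `|v - y.2|) @[y --> (x, v)] -->
      d%:R * C * (`|x - x| + `|v - v|).
    apply: cvgM; first exact: cvg_cst.
    by apply: cvgD; apply: cvg_norm; apply: cvgB;
      [exact: cvg_cst|exact: cvg_fst|exact: cvg_cst|exact: cvg_snd].
  rewrite !subrr normr0 addr0 mulr0 => /cvgrPdist_le/(_ _ e0).
  apply: filterS => -[y w] /=; rewrite sub0r normrN => h.
  by rewrite (le_trans (lip _ _ _ _))// (le_trans (ler_norm _)).
have [r r0 hr] := test_function_support.
exists (`|phi (0, 0, 0)| + d%:R * C * (r + r)) => -[x v].
have pos : 0 <= `|phi (0, 0, 0)| + d%:R * C * (r + r).
  by rewrite addr_ge0// mulr_ge0// ?mulr_ge0// addr_ge0// ltW.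
have [xr|xr] := leP `|x| r; last by rewrite hr ?normr0//; left.
have [vr|vr] := leP `|v| r; last by rewrite hr ?normr0//; right; left.
rewrite -[phi (x, v, 0)](subrK (phi (0, 0, 0))) (le_trans (ler_normD _ _))//.
rewrite addrC lerD2l (le_trans (lip _ _ _ _))// ler_wpM2l ?mulr_ge0//.
by rewrite !subr0 lerD.
Qed.

(** The increment telescopes: position, then velocity, both at time [s], then time with [g t] and
    [dg t] frozen. [chain_rule_block] handles the first two pieces through the joint continuity of
    the gradients; the last is the quotient defining [Dt]. *)
Lemma test_chain_rule (g dg ddg : R -> 'rV[R]_d) :
  (forall t, 0 <= t -> has_hderive g t (dg t)) ->
  (forall t, 0 <= t -> has_hderive dg t (ddg t)) ->
  forall t, 0 <= t ->
  has_hderive (fun s => phi (g s, dg s, s)) t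
    (Dt phi (g t, dg t, t) + dot (dg t) (Dx phi (g t, dg t, t))
     + dot (ddg t) (Dv phi (g t, dg t, t))).
Proof.
case: phi_test => dphi [cx cv ct] _ hg hdg t t0.
have gt : g s @[s --> punctured t] --> g t by exact: has_hderive_cvg (hg t t0).
have dgt : dg s @[s --> punctured t] --> dg t by exact: has_hderive_cvg (hdg t t0).
have idt : s @[s --> punctured t] --> t by move=> P; exact: punctured_nbhs.
have E1 : (s - t)^-1 *: (phi (g s, dg s, s) - phi (g t, dg s, s))
    @[s --> punctured t] --> dot (Dx phi (g t, dg t, t)) (dg t).
  apply: (@chain_rule_block R d (fun s y => phi (y, dg s, s)) g) => //.
  - by move=> s s0 y; case: (dphi y (dg s) s s0).
  - move=> c cc; apply: (@within_comp_cvg _ _ _ _ _ (Dx phi) (fun s => (c s, dg s, s))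
    (g t, dg t, t) _ cx) => //.
      exact: cvg_pair (cvg_pair cc dgt) idt.
    exact: punctured_ge0.
  - exact: hg.
have E2 : (s - t)^-1 *: (phi (g t, dg s, s) - phi (g t, dg t, s))
    @[s --> punctured t] --> dot (Dv phi (g t, dg t, t)) (ddg t).
  apply: (@chain_rule_block R d (fun s y => phi (g t, y, s)) dg) => //.
  - by move=> s s0 y; case: (dphi (g t) y s s0).
  - move=> c cc; apply: (@within_comp_cvg _ _ _ _ _ (Dv phi) (fun s => (g t, c s, s))
    (g t, dg t, t) _ cv) => //.
      exact: cvg_pair (cvg_pair (cvg_cst _) cc) idt.
    exact: punctured_ge0.
  - exact: hdg.
have E3 : (s - t)^-1 *: (phi (g t, dg t, s) - phi (g t, dg t, t))
    @[s --> punctured t] --> Dt phi (g t, dg t, t).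
  by case: (dphi (g t) (dg t) t t0) => _ _ /hderivableP.
rewrite (dotC (dg t)) (dotC (ddg t)) -addrA addrC.
apply: cvg_trans (cvgD (cvgD E1 E2) E3); apply: near_eq_cvg.
by apply: nearW => s; rewrite !fctE /GRing.scale/=; ring.
Qed.

End TestFunctions.

(** * Fundamental theorem of calculus on the half-line *)

Section FundamentalTheorem.
Context {R : realType}.
Notation mu := (@lebesgue_measure R).
Variables (g G : R -> R) (T : R).
Hypothesis T0 : 0 < T.
Hypothesis dg : forall t, 0 <= t -> has_hderive g t (G t).
Hypothesis cG : {within halfline, continuous G}.

Lemma segment_halfline : `[0, T]%classic `<=` (halfline : set R).
Proof. by move=> t /=; rewrite in_itv/= => /andP[]. Qed.

Lemma FTC_halfline : \int[mu]_(t in `[0, T]) G t = g T - g 0.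
Proof.
have cg := has_hderive_continuous dg.
have cgT : {within `[0, T], continuous g} by exact: continuous_subspaceW
    segment_halfline cg.
have [_ c0 cT] := (continuous_within_itvP g T0).1 cgT.
rewrite /Rintegral (@continuous_FTC2 _ G g 0 T)//.
- exact: continuous_subspaceW segment_halfline cG.
- split => // t; rewrite in_itv/= => /andP[t0 _].
  by have [] := has_hderive_is_derive t0 (dg (ltW t0)).
- move=> t; rewrite in_itv/= => /andP[t0 _]; rewrite derive1E.
  by have [] := has_hderive_is_derive t0 (dg (ltW t0)).
Qed.

Hypothesis G0 : forall t, T < t -> G t = 0.

Lemma restrict_halfline_segment : (G \_ `[0, +oo[ = G \_ `[0, T])%classic.
Proof.
apply/funext => t; rewrite !patchE.
have [t0|t0] := leP 0 t; last first.
  by rewrite !memNset//= in_itv/= leNgt t0.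
rewrite mem_set/=; last by rewrite in_itv/= t0.
case: ifPn => // tT; rewrite G0// ltNge; apply: contra tT => tT.
by rewrite mem_set//= in_itv/= t0.
Qed.

Lemma Rintegral_halfline : \int[mu]_(t in `[0, +oo[) G t = g T - g 0.
Proof.
by rewrite Rintegral_mkcond restrict_halfline_segment -Rintegral_mkcond FTC_halfline.
Qed.

End FundamentalTheorem.

(** * The force field *)

Lemma cvg_subl {R : numFieldType} {V : normedModType R} (x y : V) :
  x - z @[z --> y] --> x - y.
Proof. by apply: cvgB; [exact: cvg_cst|exact: cvg_id]. Qed.

Lemma continuous_comp_fst {U V S : topologicalType} (g : U -> S) :
  continuous g -> continuous (fun z : U * V => g z.1).
Proof.
move=> cg z; apply: (@continuous_comp _ _ _ (@fst U V) g z); last exact: cg.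
exact: cvg_fst.
Qed.

Section Force.
Context {R : realType} {d : nat}.

Definition weight (z : phase R d) : R := 1 + `|z.1| + `|z.2|.

(** The sup-norm form of the class on which convergence of integrals is assumed;
    [linear_growth_ubound] makes the link. *)
Definition linear_growth (g : phase R d -> R) : Prop :=
  continuous g /\ exists C, forall z, `|g z| <= C * weight z.

Lemma weight_ge1 z : 1 <= weight z.
Proof. by rewrite /weight -addrA lerDl addr_ge0. Qed.

Lemma bounded_linear_growth (g : phase R d -> R) (C : R) :
  continuous g -> (forall z, `|g z| <= C) -> linear_growth g.
Proof.
move=> cg gC; split=> //; exists C => z; rewrite (le_trans (gC z))//.
by rewrite ler_peMr ?weight_ge1// (le_trans _ (gC z)).
Qed.

Lemma weight_continuous : continuous weight.
Proof.
move=> z; apply: cvgD; last by apply: cvg_norm; exact: cvg_snd.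
by apply: cvgD; [exact: cvg_cst|apply: cvg_norm; exact: cvg_fst].
Qed.

Lemma linear_growth_integrable (mu : Pborel R (phase R d)) g :
  mu.-integrable setT (EFin \o weight) -> linear_growth g ->
  mu.-integrable setT (EFin \o g).
Proof.
move=> iw [cg [C gC]]; apply: (dominated_integrable cg gC).
exact: integrable_scale.
Qed.

Context (W : 'rV[R]_d -> R) (B : R).
Hypothesis B0 : 0 <= B.
Hypothesis W_cont : continuous (grad W).
Hypothesis W_growth : forall z, `|grad W z| <= B * (1 + `|z|).

(* The weight |y|^2 absorbs the linear growth of the gradient at infinity, so a
   second moment bound turns this into equicontinuity of the forces. *)
Lemma grad_equicontinuous (x0 : 'rV[R]_d) (e : R) : 0 < e ->
  \forall x \near x0, forall y : 'rV[R]_d,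
    `|grad W (x - y) - grad W (x0 - y)| <= e * (1 + `|y| ^+ 2).
Proof.
(* For [|y| > r] both gradients are at most [B * (3 + |x0|) * |y|], and [r] is such that twice this
   is below [e * |y|^2]. The summand 1 ensures [|y| >= 1]. *)
move=> e0; pose r := 1 + 2 * B * (3 + `|x0|) / e.
have r1 : 1 <= r.
  by rewrite lerDl divr_ge0 ?(ltW e0)// !mulr_ge0// addr_ge0.
pose K : set 'rV[R]_d := [set y | `|y| <= r].
have cK : compact K by exact: norm_ball_compact.
(* On the ball, compactness upgrades continuity at each pair [(y, x0)] to a neighbourhood of [x0]
   valid for all [y]. *)
have near_K : \forall x \near x0,
    K `<=` [set y | `|grad W (x - y) - grad W (x0 - y)| <= e].
  move/compact_near_coveringP : cK => cK.
  apply: (cK _ (nbhs x0) (fun x y => `|grad W (x - y) - grad W (x0 - y)| <= e)) => y _.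
  have cvg0 : grad W (q.2 - q.1) - grad W (x0 - q.1) @[q --> (y, x0)] --> 
      grad W (x0 - y) - grad W (x0 - y).
    have s1 : q.2 - q.1 @[q --> (y, x0)] --> x0 - y.
      by apply: cvgB; [exact: cvg_snd|exact: cvg_fst].
    have s2 : x0 - q.1 @[q --> (y, x0)] --> x0 - y.
      by apply: cvgB; [exact: cvg_cst|exact: cvg_fst].
    apply: cvgB; first exact: (cvg_comp _ _ s1 (@W_cont (x0 - y))).
    exact: (cvg_comp _ _ s2 (@W_cont (x0 - y))).
  move: cvg0; rewrite subrr => /cvgr0Pnorm_le/(_ _ e0).
  exact.
near=> x => y.
have [yr|yr] := leP `|y| r.
  rewrite (@le_trans _ _ e)//; last by rewrite ler_pMr// lerDl sqr_ge0.
  by have : K y by []; apply: (near near_K x).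
have xx0 : `|x - x0| <= 1.
  by rewrite distrC; near: x; apply: cvgr_dist_le => //; exact: cvg_id.
have nx : `|x| <= 1 + `|x0|.
  by rewrite -[x](subrK x0) (le_trans (ler_normD _ _))// lerD2r.
have h1 : `|grad W (x - y)| <= B * (2 + `|x0| + `|y|).
  rewrite (le_trans (W_growth _))// ler_wpM2l//.
  by have := ler_normB x y; lra.
have h2 : `|grad W (x0 - y)| <= B * (2 + `|x0| + `|y|).
  rewrite (le_trans (W_growth _))// ler_wpM2l//.
  by have := ler_normB x0 y; lra.
have y1 : 1 <= `|y| by rewrite (le_trans r1)// ltW.
rewrite (le_trans (ler_normB _ _))// (le_trans (lerD h1 h2))//.
have h3 : B * (2 + `|x0| + `|y|) <= B * ((3 + `|x0|) * `|y|).
  rewrite ler_wpM2l//.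
  have : 0 <= `|x0| * (`|y| - 1) by rewrite mulr_ge0// subr_ge0.
  by rewrite mulrBr mulr1; lra.
have h4 : 2 * B * (3 + `|x0|) <= e * `|y|.
  by rewrite [leRHS]mulrC -ler_pdivrMr// (le_trans _ (ltW yr))// /r lerDr.
have h5 : 2 * B * (3 + `|x0|) * `|y| <= e * `|y| * `|y| by rewrite ler_wpM2r.
have -> : e * (1 + `|y| ^+ 2) = e + e * `|y| * `|y| by rewrite mulrDr mulr1 expr2 mulrA.
move: h3 h5; lra.
Unshelve. all: by end_near. Qed.

Notation mforce mu := (force W (spatial_marginal mu)).

Lemma grad_shift_growth (x y : 'rV[R]_d) : `|grad W (x - y)| <= B * (1 + `|x| + `|y|).
Proof.
rewrite (le_trans (W_growth _))// ler_wpM2l// -addrA lerD2l.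
exact: ler_normB.
Qed.

Lemma grad_shift_continuous (x : 'rV[R]_d) i :
  continuous (fun y : 'rV[R]_d => grad W (x - y) ord0 i).
Proof.
move=> y; have h : grad W (x - z) @[z --> y] --> grad W (x - y).
  exact: (cvg_comp _ _ (@cvg_subl _ _ x y) (@W_cont (x - y))).
exact: (coord_cont h).
Qed.

Lemma grad_shift_linear_growth (x : 'rV[R]_d) i :
  linear_growth (fun z => grad W (x - z.1) ord0 i).
Proof.
split; first exact: (continuous_comp_fst (@grad_shift_continuous x i)).
exists (B * (1 + `|x|)) => z; rewrite (le_trans (le_coord_norm _ _))//.
rewrite (le_trans (grad_shift_growth _ _))// -mulrA ler_wpM2l// /weight.
have h1 : 0 <= `|x| * `|z.1| by rewrite mulr_ge0.
have h2 : 0 <= (1 + `|x|) * `|z.2| by rewrite mulr_ge0// addr_ge0.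
by have := normr_ge0 (z.1); rewrite !mulrDr mulr1; lra.
Qed.

Section OneMeasure.
Context (mu : Pborel R (phase R d)).
Hypothesis mu_weight : mu.-integrable setT (EFin \o weight).

Lemma marginal_integrable (x : 'rV[R]_d) i :
  (spatial_marginal mu).-integrable setT (fun y => (grad W (x - y) ord0 i)%:E).
Proof.
apply: integrable_pushforward => //.
- by apply/measurable_EFinP; exact: (continuous_borel_measurable
  (@grad_shift_continuous x i)).
- rewrite preimage_setT.
  exact: (linear_growth_integrable mu_weight (grad_shift_linear_growth x i)).
Qed.

(** Moving the integral from the marginal to phase space turns each coordinate of the force into the
    integral of a [linear_growth] function. *)
Lemma forceE (x : 'rV[R]_d) i :
  mforce mu x ord0 i = \int[mu]_z grad W (x - z.1) ord0 i.
Proof.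
rewrite mxE /Rintegral integral_pushforward//.
- by apply/measurable_EFinP; exact: (continuous_borel_measurable
  (@grad_shift_continuous x i)).
- rewrite preimage_setT.
  exact: (linear_growth_integrable mu_weight (grad_shift_linear_growth x i)).
Qed.

Lemma norm_fst_integrable : mu.-integrable setT (EFin \o (fun z : phase R d => `|z.1|)).
Proof.
apply: (linear_growth_integrable mu_weight); split.
  by move=> z; apply: cvg_norm; exact: cvg_fst.
exists 1 => z; rewrite mul1r normr_id /weight.
by have := normr_ge0 z.2; lra.
Qed.

Lemma norm_force_le (x : 'rV[R]_d) :
  `|mforce mu x| <= B * (1 + `|x| + \int[mu]_z `|z.1|).
Proof.
have i1 : mu.-integrable setT (EFin \o (fun z : phase R d => B * `|z.1|)).
  by apply: integrable_scale; exact norm_fst_integrable.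
have ge0 : 0 <= \int[mu]_z `|z.1| by exact: Rintegral_ge0.
apply: norm_le_coord => [|i]; first by rewrite mulr_ge0 ?addr_ge0.
rewrite forceE.
have -> : B * (1 + `|x| + \int[mu]_z `|z.1|) =
    \int[mu]_z (B * (1 + `|x|) + B * `|z.1|).
  rewrite RintegralD//; last exact: cst_integrable.
  rewrite (Rintegral_prob_cst mu) RintegralZl//; last exact norm_fst_integrable.
  by rewrite mulrDr.
apply: normr_Rintegral_le.
- by case: (grad_shift_linear_growth x i).
- by move=> z; rewrite (le_trans (le_coord_norm _ _))// -mulrDr grad_shift_growth.
- by apply: integrable_add => //; exact: cst_integrable.
Qed.

Hypothesis mu_sqr : mu.-integrable setT (EFin \o (fun z : phase R d => `|z.1| ^+ 2)).

Lemma force_modulus (x x0 : 'rV[R]_d) (e : R) : 0 <= e ->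
  (forall y : 'rV[R]_d, `|grad W (x - y) - grad W (x0 - y)| <= e * (1 + `|y| ^+ 2)) ->
  `|mforce mu x - mforce mu x0| <= e * (1 + \int[mu]_z (`|z.1| ^+ 2)).
Proof.
move=> e0 h; have ge0 : 0 <= \int[mu]_z (`|z.1| ^+ 2) by apply: Rintegral_ge0 => z _;
  exact: sqr_ge0.
have lgB i : linear_growth
    (fun z : phase R d => grad W (x - z.1) ord0 i - grad W (x0 - z.1) ord0 i).
  have [c1 [C1 h1]] := grad_shift_linear_growth x i.
  have [c2 [C2 h2]] := grad_shift_linear_growth x0 i.
  split; first by move=> z; apply: cvgB; [exact: c1|exact: c2].
  exists (C1 + C2) => z; rewrite (le_trans (ler_normB _ _))// mulrDl.
  by rewrite lerD.
apply: norm_le_coord => [|i]; first by rewrite mulr_ge0 ?addr_ge0.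
have i1 := linear_growth_integrable mu_weight (grad_shift_linear_growth x i).
have i2 := linear_growth_integrable mu_weight (grad_shift_linear_growth x0 i).
have -> : (mforce mu x - mforce mu x0) ord0 i =
    \int[mu]_z (grad W (x - z.1) ord0 i - grad W (x0 - z.1) ord0 i).
  rewrite coordB RintegralB//.
  congr (_ - _); first exact: forceE.
  exact: forceE.
have -> : e * (1 + \int[mu]_z (`|z.1| ^+ 2)) = \int[mu]_z (e * (1 + `|z.1| ^+ 2)).
  rewrite RintegralZl//; last by apply: integrable_add => //; exact: cst_integrable.
  by rewrite RintegralD//; [rewrite (Rintegral_prob_cst mu)|exact: cst_integrable].
apply: normr_Rintegral_le.
- by case: (lgB i).
- by move=> z; rewrite -coordB (le_trans (le_coord_norm _ _)).
- by apply: integrable_scale; apply: integrable_add => //; exact: cst_integrable.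
Qed.

End OneMeasure.

Section Limit.
Context (mu_ : nat -> Pborel R (phase R d)) (mu : Pborel R (phase R d)) (M : R).
Hypothesis mu__weight : forall j, (mu_ j).-integrable setT (EFin \o weight).
Hypothesis mu__sqr : forall j,
  (mu_ j).-integrable setT (EFin \o (fun z : phase R d => `|z.1| ^+ 2)).
Hypothesis mu_weight : mu.-integrable setT (EFin \o weight).
Hypothesis M0 : 0 <= M.
Hypothesis sqr_le : \forall j \near \oo, \int[mu_ j]_z (`|z.1| ^+ 2) <= M.
Hypothesis mu_cvg : forall g, linear_growth g ->
  \int[mu_ j]_z g z @[j --> \oo] --> \int[mu]_z g z.

Lemma force_pointwise_cvg (x : 'rV[R]_d) :
  mforce (mu_ j) x @[j --> \oo] --> mforce mu x.
Proof.
apply: cvg_coord => i; rewrite forceE//.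
under eq_cvg do rewrite forceE//.
exact: mu_cvg (grad_shift_linear_growth x i).
Qed.

(** The neighbourhood comes from [grad_equicontinuous] with [e / (1 + M)], so it does not depend on
    [j]. No second moment of [mu] enters: its bound is the limit of those for [mu_ j], by pointwise
    convergence. *)
Lemma force_limit_modulus (x0 : 'rV[R]_d) (e : R) : 0 < e ->
  \forall x \near x0, `|mforce mu x - mforce mu x0| <= e /\
    forall j, \int[mu_ j]_z (`|z.1| ^+ 2) <= M ->
      `|mforce (mu_ j) x - mforce (mu_ j) x0| <= e.
Proof.
move=> e0; pose e' := e / (1 + M).
have M1 : 0 < 1 + M by rewrite ltr_wpDr.
have e'0 : 0 < e' by rewrite divr_gt0.
apply: filterS (grad_equicontinuous x0 e'0) => x hx.
have hj j : \int[mu_ j]_z (`|z.1| ^+ 2) <= M ->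
    `|mforce (mu_ j) x - mforce (mu_ j) x0| <= e.
  move=> hj.
  rewrite (le_trans (force_modulus (mu__weight j) (mu__sqr j) (ltW e'0) hx))//.
  by rewrite /e' mulrAC ler_pdivrMr// ler_wpM2l ?(ltW e0)// lerD2l.
split => //.
have cv : `|mforce (mu_ j) x - mforce (mu_ j) x0| @[j --> \oo] -->
    `|mforce mu x - mforce mu x0|.
  by apply: cvg_norm; apply: cvgB; exact: force_pointwise_cvg.
rewrite -(cvg_lim _ cv)//; apply: limr_le; first exact: cvgP cv.
exact: filterS hj sqr_le.
Qed.

Lemma force_continuous : continuous (mforce mu).
Proof.
suff h (x0 : 'rV[R]_d) : mforce mu x @[x --> x0] --> mforce mu x0 by move=> x0;
  exact: h.
apply/(@cvgrPdist_le _ 'rV[R]_d _ (nbhs x0)) => e e0; near=> x.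
rewrite distrC.
by have [] := near (force_limit_modulus x0 e0) x.
Unshelve. all: by end_near. Qed.

(** Equicontinuity spreads pointwise convergence at [x0] to nearby [x], at the price of three terms
    [e / 3]; compactness of the ball makes the index uniform. *)
Lemma force_locally_uniform_cvg (r e : R) : 0 < e ->
  \forall j \near \oo, forall x : 'rV[R]_d, `|x| <= r ->
    `|mforce (mu_ j) x - mforce mu x| <= e.
Proof.
move=> e0; have e30 : 0 < e / 3 by rewrite divr_gt0.
have /compact_near_coveringP cK := @norm_ball_compact R d r.
apply: (cK _ \oo (fun j x => `|mforce (mu_ j) x - mforce mu x| <= e)) => x0 _.
have hx := force_limit_modulus x0 e30.
have hj : \forall j \near \oo, \int[mu_ j]_z (`|z.1| ^+ 2) <= M /\
    `|mforce (mu_ j) x0 - mforce mu x0| <= e / 3.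
  apply: filterI; first exact: sqr_le.
  have /cvgrPdist_le/(_ _ e30) := @force_pointwise_cvg x0.
  by apply: filterS => j; rewrite distrC.
exists ([set x | `|mforce mu x - mforce mu x0| <= e / 3 /\
    forall j, \int[mu_ j]_z (`|z.1| ^+ 2) <= M ->
      `|mforce (mu_ j) x - mforce (mu_ j) x0| <= e / 3],
  [set j | \int[mu_ j]_z (`|z.1| ^+ 2) <= M /\
    `|mforce (mu_ j) x0 - mforce mu x0| <= e / 3]) => //.
move=> [x j] /= [[h1 h2] [h3 h4]].
have -> : mforce (mu_ j) x - mforce mu x = (mforce (mu_ j) x - mforce (mu_ j) x0)
   + (mforce (mu_ j) x0 - mforce mu x0) - (mforce mu x - mforce mu x0).
  by rewrite addrA subrK opprB addrA subrK.
rewrite [leRHS](_ : e = e / 3 + e / 3 + e / 3); last by field.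
apply: le_trans (ler_normB _ _) (lerD _ h1).
exact: le_trans (ler_normD _ _) (lerD (h2 j h3) h4).
Qed.

End Limit.

(** [mu] is the limit of the constant sequence, with its own second moment as the bound [M]. *)
Lemma force_continuous1 (mu : Pborel R (phase R d)) :
  mu.-integrable setT (EFin \o weight) ->
  mu.-integrable setT (EFin \o (fun z : phase R d => `|z.1| ^+ 2)) ->
  continuous (mforce mu).
Proof.
move=> iw i2; apply: (@force_continuous (fun=> mu) mu (\int[mu]_z (`|z.1| ^+ 2))) => //.
- by apply: Rintegral_ge0 => z _; exact: sqr_ge0.
- exact: nearW.
- by move=> g _; exact: cvg_cst.
Qed.

End Force.

(** * The transport integrand: bounds and convergence at a fixed time *)

Section Transport.
Context {R : realType} {d : nat}.
Context (W : 'rV[R]_d -> R) (B : R).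
Hypothesis B0 : 0 <= B.
Hypothesis W_cont : continuous (grad W).
Hypothesis W_growth : forall z, `|grad W z| <= B * (1 + `|z|).
Context (phi : phase R d * R -> R).
Hypothesis phi_test : test_function phi.

Notation mforce mu := (force W (spatial_marginal mu)).

Lemma within_slice_continuous {V : topologicalType} (P : phase R d * R -> V) (t : R) :
  {within [set p : phase R d * R | 0 <= p.2], continuous P} -> 0 <= t ->
  continuous (fun z => P (z, t)).
Proof.
move=> cP t0 z.
apply: (@within_comp_cvg _ _ _ (nbhs z) _ P (fun w => (w, t)) (z, t) _ cP) => //.
  have idz : w @[w --> z] --> z by move=> Q.
  exact: (cvg_pair idz (cvg_cst t)).
by near=> w.
Unshelve. all: by end_near. Qed.

(** The part of [transport] whose integrand does not depend on the measure, so that its integral is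
    linear in the measure. *)
Definition kinetic (t : R) (z : phase R d) : R :=
  Dt phi (z, t) + dot z.2 (Dx phi (z, t)).

Lemma kinetic_continuous t : 0 <= t -> continuous (kinetic t).
Proof.
move=> t0; case: phi_test => _ [cx _ ct] _ z; apply: cvgD.
  exact: within_slice_continuous ct t0 z.
apply: cvg_dot; first exact: cvg_snd.
exact: within_slice_continuous cx t0 z.
Qed.

(** The factor [z.2] is unbounded, but [Dx phi] vanishes once [|z.2| > r]. *)
Lemma kinetic_bounded : exists2 C : R, 0 <= C &
  forall t, 0 <= t -> forall z, `|kinetic t z| <= C.
Proof.
have [C C0 hC] := test_derivatives_bounded phi_test.
have [r r0 hr] := test_derivatives_support phi_test.
exists (C + d%:R * (r * C)) => [|t t0 z]; first by rewrite addr_ge0// !mulr_ge0// ltW.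
have [h1 _ h3] := hC z t t0; rewrite (le_trans (ler_normD _ _))// lerD//.
have [zr|zr] := leP `|z.2| r.
  rewrite (le_trans (normr_dot_le _ _))// ler_wpM2l//.
  by rewrite ler_pM.
case: z zr h1 h3 => x v /= zr _ _.
have [-> _ _] := hr x v t t0 (or_intror (or_introl zr)).
by rewrite dot0r normr0 !mulr_ge0// ltW.
Qed.

Lemma force_term_continuous (mu : Pborel R (phase R d)) (t : R) : 0 <= t ->
  continuous (mforce mu) ->
  continuous (fun z : phase R d => dot (mforce mu z.1) (Dv phi (z, t))).
Proof.
move=> t0 cF; case: phi_test => _ [_ cv _] _ z; apply: cvg_dot.
  exact: (continuous_comp_fst cF).
exact: within_slice_continuous cv t0 z.
Qed.

(** On the support [|z.1| <= r], hence [1 + |z.1| + I <= (1 + r) * (1 + I)] with [I] the first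
    moment of [mu]. The constant is the same for all measures and times, as the domination in time
    requires. *)
Lemma force_term_bounded : exists2 C : R, 0 <= C &
  forall (mu : Pborel R (phase R d)), mu.-integrable setT (EFin \o weight) ->
  forall t, 0 <= t -> forall z : phase R d,
    `|dot (mforce mu z.1) (Dv phi (z, t))| <= C * (1 + \int[mu]_w `|w.1|).
Proof.
have [C C0 hC] := test_derivatives_bounded phi_test.
have [r r0 hr] := test_derivatives_support phi_test.
have r'0 := ltW r0.
exists (d%:R * (B * (1 + r) * C)) => [|mu iw t t0 z].
  by rewrite !mulr_ge0// addr_ge0.
have i0 : 0 <= \int[mu]_w `|w.1| by exact: Rintegral_ge0.
have [_ h2 _] := hC z t t0.
have [zr|zr] := leP `|z.1| r; last first.
  case: z zr h2 => x v /= zr _.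
  have [_ -> _] := hr x v t t0 (or_introl zr).
  by rewrite dot0r normr0 !mulr_ge0// addr_ge0.
rewrite (le_trans (normr_dot_le _ _))// -mulrA ler_wpM2l//
  -mulrA [C * _]mulrC mulrA ler_pM//.
rewrite (le_trans (norm_force_le B0 W_cont W_growth iw _))// -mulrA ler_wpM2l//.
have : 0 <= r * \int[mu]_w `|w.1| by rewrite mulr_ge0.
lra.
Qed.

Lemma transport_continuous (f : R -> Pborel R (phase R d)) (t : R) : 0 <= t ->
  continuous (mforce (f t)) -> continuous (transport W f phi t).
Proof.
move=> t0 cF z; apply: cvgB; first exact: kinetic_continuous.
exact: force_term_continuous.
Qed.

Lemma transport_bounded : exists2 C : R, 0 <= C &
  forall (f : R -> Pborel R (phase R d)) t, 0 <= t ->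
      (f t).-integrable setT (EFin \o weight) ->
   forall z, `|transport W f phi t z| <= C * (1 + \int[f t]_w `|w.1|).
Proof.
have [C1 C10 h1] := kinetic_bounded; have [C2 C20 h2] := force_term_bounded.
exists (C1 + C2) => [|f t t0 iw z]; first exact: addr_ge0.
have i0 : 0 <= \int[f t]_w `|w.1| by exact: Rintegral_ge0.
rewrite (le_trans (ler_normB _ _))// mulrDl lerD ?h2//.
by rewrite (le_trans (h1 t t0 z))// ler_peMr// lerDl.
Qed.

Section Limit.
Context (f_ : nat -> R -> Pborel R (phase R d)) (f : R -> Pborel R (phase R d)).
Context (t M : R).
Hypothesis t0 : 0 <= t.
Hypothesis f__weight : forall j, (f_ j t).-integrable setT (EFin \o weight).
Hypothesis f__sqr : forall j,
  (f_ j t).-integrable setT (EFin \o (fun z : phase R d => `|z.1| ^+ 2)).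
Hypothesis f_weight : (f t).-integrable setT (EFin \o weight).
Hypothesis M0 : 0 <= M.
Hypothesis sqr_le : \forall j \near \oo, \int[f_ j t]_z (`|z.1| ^+ 2) <= M.
Hypothesis f_cvg : forall g, linear_growth g ->
  \int[f_ j t]_z g z @[j --> \oo] --> \int[f t]_z g z.

Lemma limit_force_continuous : continuous (mforce (f t)).
Proof.
exact: (@force_continuous _ _ _ _ B0 W_cont W_growth (fun j => f_ j t) (f t) M).
Qed.

Lemma approx_force_continuous j : continuous (mforce (f_ j t)).
Proof. exact: (@force_continuous1 _ _ _ _ B0 W_cont W_growth). Qed.

(** The double dependence is split. With the limit force frozen, the integrand [psi] is a fixed
    bounded continuous function, to which [f_cvg] applies; the error [psi_ j - psi] is uniformly
    small, because the forces converge uniformly on the support of [Dv phi]. *)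
Lemma force_term_cvg :
  \int[f_ j t]_z dot (mforce (f_ j t) z.1) (Dv phi (z, t)) @[j --> \oo] -->
  \int[f t]_z dot (mforce (f t) z.1) (Dv phi (z, t)).
Proof.
have [C C0 hC] := test_derivatives_bounded phi_test.
have [r r0 hr] := test_derivatives_support phi_test.
have [C' C'0 hC'] := force_term_bounded.
pose psi (z : phase R d) : R := dot (mforce (f t) z.1) (Dv phi (z, t)).
pose psi_ j (z : phase R d) : R := dot (mforce (f_ j t) z.1) (Dv phi (z, t)).
have cpsi : continuous psi by exact: force_term_continuous t0 limit_force_continuous.
have cpsi_ j : continuous (psi_ j) by exact: force_term_continuous t0
    (@approx_force_continuous j).
have psi_cvg : \int[f_ j t]_z psi z @[j --> \oo] --> \int[f t]_z psi z.
  by apply: f_cvg; apply: bounded_linear_growth cpsi _; exact: hC' f_weight t t0.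
have diff_cvg : \int[f_ j t]_z (psi_ j z - psi z) @[j --> \oo] --> 0.
  apply/cvgr0Pnorm_le => e e0.
  (* Chosen so that [d * e' * C <= e]; the added 1 avoids a zero denominator. *)
  pose e' := e / (d%:R * C + 1).
  have dC0 : 0 <= d%:R * C by rewrite mulr_ge0.
  have e'0 : 0 < e' by rewrite divr_gt0// ltr_wpDl.
  have := @force_locally_uniform_cvg _ _ _ _ B0 W_cont W_growth (fun j => f_ j t)
      (f t) M
    f__weight f__sqr f_weight M0 sqr_le f_cvg r e' e'0.
  apply: filterS => j hj; apply: normr_Rintegral_bounded.
    by move=> z; apply: cvgB; [exact: cpsi_|exact: cpsi].
  move=> [x v]; rewrite /psi_ /psi -dotBl/=.
  have [xr|xr] := leP `|x| r; last first.
    by have [_ -> _] := hr x v t t0 (or_introl xr); rewrite dot0r normr0 ltW.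
  rewrite (le_trans (normr_dot_le _ _))//.
  have [_ h2 _] := hC (x, v) t t0.
  rewrite (@le_trans _ _ (d%:R * (e' * C)))//; first by rewrite ler_wpM2l// ler_pM// hj.
  rewrite mulrCA /e' mulrAC -mulrA ler_piMr ?(ltW e0)//.
  by rewrite ler_pdivrMr ?mul1r ?lerDl// ltr_wpDl.
rewrite -[X in _ --> X]add0r.
apply: cvg_trans (cvgD diff_cvg psi_cvg); apply: near_eq_cvg; apply: nearW => j.
rewrite !fctE -RintegralD//.
- by apply: eq_Rintegral => z _; rewrite subrK.
- apply: (@bounded_integrable _ _ _ _
    (C' * (1 + \int[f_ j t]_w `|w.1|) + C' * (1 + \int[f t]_w `|w.1|))).
    by move=> z; apply: cvgB; [exact: cpsi_|exact: cpsi].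
  move=> z; rewrite (le_trans (ler_normB _ _))// lerD//.
    exact: hC' (f__weight j) t t0 z.
  exact: hC' f_weight t t0 z.
- exact: (bounded_integrable _ cpsi (hC' _ f_weight t t0)).
Qed.

Lemma transport_cvg :
  \int[f_ j t]_z transport W (f_ j) phi t z @[j --> \oo] -->
  \int[f t]_z transport W f phi t z.
Proof.
have [C1 C10 h1] := kinetic_bounded; have [C2 C20 h2] := force_term_bounded.
have ck := kinetic_continuous t0.
have E (g : R -> Pborel R (phase R d)) : (g t).-integrable setT (EFin \o weight) ->
    continuous (mforce (g t)) ->
    \int[g t]_z transport W g phi t z = \int[g t]_z kinetic t z
     - \int[g t]_z dot (mforce (g t) z.1) (Dv phi (z, t)).
  move=> iw cF; rewrite -RintegralB//.
    exact: (bounded_integrable _ ck (h1 t t0)).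
  exact: (bounded_integrable _ (force_term_continuous t0 cF) (h2 _ iw t t0)).
have E' j := E (f_ j) (f__weight j) (@approx_force_continuous j).
rewrite (E f f_weight limit_force_continuous).
under eq_cvg do rewrite E'.
apply: cvgB; last exact: force_term_cvg.
exact: f_cvg (bounded_linear_growth ck (h1 t t0)).
Qed.

End Limit.

End Transport.

(** * Particle systems *)

Section Newton.
Context {R : realType} {d : nat}.
#[local] Existing Instance punctured_filter.
Context (W : 'rV[R]_d -> R) (B : R).
Hypothesis B0 : 0 <= B.
Hypothesis W_cont : continuous (grad W).
Hypothesis W_growth : forall z, `|grad W z| <= B * (1 + `|z|).
Context (N : nat) (m : 'I_N -> R) (x v : 'I_N -> 'rV[R]_d)
    (gamma : 'I_N -> R -> 'rV[R]_d).
Hypothesis m_gt0 : forall i, 0 < m i.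
Hypothesis m_sum : \sum_(i < N) m i = 1.
Hypothesis newton : newton_solution W m x v gamma.

Notation dgamma i := (hderive (gamma i)).
Notation ddgamma i := (hderive (hderive (gamma i))).

Lemma newton_hderive i t : 0 <= t -> has_hderive (gamma i) t (dgamma i t).
Proof. by case: newton => /(_ i)[h _ _] _ _ _ t0; exact/hderivableP/h. Qed.

Lemma newton_hderive2 i t : 0 <= t -> has_hderive (dgamma i) t (ddgamma i t).
Proof. by case: newton => /(_ i)[_ h _] _ _ _ t0; exact/hderivableP/h. Qed.

Lemma halfline_continuous_cvg {V : normedModType R} (g : R -> V) t : 0 <= t ->
  {within halfline, continuous g} -> g s @[s --> punctured t] --> g t.
Proof.
move=> t0 /subspace_continuousP/(_ t t0) h P /h hP.
exact: punctured_weaken.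
Qed.

(** Newton's law is given for [t > 0] only. Both sides are continuous on the half-line, so it
    extends to [t = 0]; dividing by the positive mass [m i] leaves the acceleration. *)
Lemma newton_eq i t : 0 <= t ->
  ddgamma i t = - \sum_(j < N) m j *: grad W (gamma i t - gamma j t).
Proof.
have [C2 eqn _ _] := newton.
have pos s : 0 < s ->
    ddgamma i s = - \sum_(j < N) m j *: grad W (gamma i s - gamma j s).
  move=> s0; have := eqn i s s0 => /(congr1 (fun u => (m i)^-1 *: u)).
  have mi0 : m i != 0 by rewrite gt_eqF.
  rewrite scalerA mulVf// scale1r => ->; rewrite scalerN scaler_sumr.
  by congr (- _); apply: eq_bigr => j _; rewrite scalerA mulrA mulVf// mul1r.
rewrite le_eqVlt => /predU1P[<-|]; last exact: pos.
have FF := @punctured_proper R 0 (lexx _).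
have l1 : ddgamma i s @[s --> punctured 0] --> ddgamma i 0.
  by apply: halfline_continuous_cvg => //; case: (C2 i).
have l2 : - \sum_(j < N) m j *: grad W (gamma i s - gamma j s) @[s --> punctured 0] -->
    - \sum_(j < N) m j *: grad W (gamma i 0 - gamma j 0).
  apply: cvgN; apply: cvg_sumr => j; apply: cvgZ; first exact: cvg_cst.
  have cc : gamma i s - gamma j s @[s --> punctured 0] --> gamma i 0 - gamma j 0.
    by apply: cvgB; apply: has_hderive_cvg; exact: newton_hderive.
  exact: (cvg_comp _ _ cc (@W_cont _)).
apply: (cvg_unique _ l1) => //.
apply: cvg_trans l2; apply: near_eq_cvg.
have h1 := punctured_ge0 (0 : R); have h2 := punctured_neq (0 : R).
by apply: filterS2 h1 h2 => s s0 sn0; rewrite pos// lt_neqAle eq_sym sn0.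
Qed.

(** Not the mechanical energy: no potential enters. It is the Euclidean second moment of the
    particle measure. *)
Definition energy (t : R) : R :=
  \sum_(i < N) m i * (dot (gamma i t) (gamma i t) + dot (dgamma i t) (dgamma i t)).

Definition denergy (t : R) : R :=
  \sum_(i < N) m i * ((dot (dgamma i t) (gamma i t) + dot (gamma i t) (dgamma i t))
   + (dot (ddgamma i t) (dgamma i t) + dot (dgamma i t) (ddgamma i t))).

Lemma energy_hderive t : 0 <= t -> has_hderive energy t (denergy t).
Proof.
move=> t0; apply: has_hderive_sum => i; apply: has_hderiveZ; apply: has_hderiveD.
  by apply: has_hderive_dot; exact: newton_hderive.
by apply: has_hderive_dot; exact: newton_hderive2.
Qed.

(** With [c = 3 * d * B^2], the estimate of [denergy_le] produces
    [(2 + c) * energy + c * (1 + energy)], which is at most [(2 + 2 * c) * (1 + energy)]. *)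
Let K := 2 + 6 * d%:R * B ^+ 2.

Lemma energy_ge0 t : 0 <= energy t.
Proof.
by apply: sumr_ge0 => i _; rewrite mulr_ge0 ?(ltW (m_gt0 i))// addr_ge0 ?dot_ge0.
Qed.

(** Young's inequality bounds both products by squares, and linear growth bounds the squared
    gradient for the pair [i, j] by [c * (1 + e i + e j)]. Averaging over [j] with masses of sum 1
    replaces [e j] by the energy, whatever the number of particles. *)
Lemma denergy_le t : 0 <= t -> denergy t <= K * (1 + energy t).
Proof.
move=> t0.
pose e i := dot (gamma i t) (gamma i t) + dot (dgamma i t) (dgamma i t).
have e0 i : 0 <= e i by rewrite addr_ge0 ?dot_ge0.
have eE : \sum_(j < N) m j * e j = energy t by [].
(* [d] comes from passing to the sup norm, [B ^+ 2] from the growth of the gradient, 3 from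
   [(1 + a + b)^2 <= 3 * (1 + a^2 + b^2)]. *)
pose c := d%:R * (B ^+ 2 * 3).
have c0 : 0 <= c by rewrite !mulr_ge0// sqr_ge0.
have amgm (a b p q r u : R) : a ^+ 2 <= p -> b ^+ 2 <= r -> 0 <= q -> 0 <= u ->
    (1 + a + b) ^+ 2 <= 3 * (1 + (p + q) + (r + u)).
  have := sqr_ge0 (1 - a); have := sqr_ge0 (1 - b); have := sqr_ge0 (a - b).
  by rewrite !expr2; lra.
have dot_grad_le i j :
    dot (grad W (gamma i t - gamma j t)) (grad W (gamma i t - gamma j t)) <=
    c * (1 + e i + e j).
  rewrite (le_trans (dot_self_le _))// /c -mulrA ler_wpM2l// -mulrA.
  rewrite (@le_trans _ _ ((B * (1 + `|gamma i t| + `|gamma j t|)) ^+ 2))//.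
    rewrite ler_pXn2r// ?nnegrE ?mulr_ge0 ?addr_ge0//.
    rewrite (le_trans (W_growth _))// ler_wpM2l// -addrA lerD2l.
    exact: ler_normB.
  rewrite exprMn ler_wpM2l ?sqr_ge0//.
  exact: amgm (norm_sqr_le_dot _) (norm_sqr_le_dot _) (dot_ge0 _) (dot_ge0 _).
have force_le i j : - (2 * dot (grad W (gamma i t - gamma j t)) (dgamma i t))
    <= e i + c * (1 + e i + e j).
  have h1 := dot_young (- grad W (gamma i t - gamma j t)) (dgamma i t).
  rewrite !dotNl dotNr opprK mulrN in h1.
  by rewrite (le_trans h1)// addrC lerD// lerDr dot_ge0.
have one i : (dot (dgamma i t) (gamma i t) + dot (gamma i t) (dgamma i t))
   + (dot (ddgamma i t) (dgamma i t) + dot (dgamma i t) (ddgamma i t)) <=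
   e i + (e i + c * (1 + e i + energy t)).
  rewrite (dotC (gamma i t) (dgamma i t)) (dotC (dgamma i t) (ddgamma i t)).
  apply: lerD.
    by rewrite -mulr2n -mulr_natl (le_trans (dot_young _ _))// addrC.
  rewrite newton_eq// dotNl dot_suml.
  have -> : - (\sum_(j < N) dot (m j *: grad W (gamma i t - gamma j t)) (dgamma i t)) +
    - (\sum_(j < N) dot (m j *: grad W (gamma i t - gamma j t)) (dgamma i t)) =
    \sum_(j < N) m j * - (2 * dot (grad W (gamma i t - gamma j t)) (dgamma i t)).
    rewrite -opprD -big_split -sumrN; apply: eq_bigr => j _ /=.
    by rewrite dotZl; move: (m j) (dot _ _) => *; ring.
  rewrite (le_trans (ler_sum _ (fun j _ => ler_wpM2l (ltW (m_gt0 j))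
    (force_le i j))))//.
  under eq_bigr do rewrite mulrDr.
  rewrite big_split/= -mulr_suml m_sum mul1r lerD2l.
  have -> : \sum_(j < N) m j * (c * (1 + e i + e j)) =
     c * (\sum_(j < N) m j * (1 + e i) + \sum_(j < N) m j * e j).
    rewrite -big_split mulr_sumr; apply: eq_bigr => j _ /=.
    by rewrite mulrCA [in LHS]mulrDr.
  by rewrite -mulr_suml m_sum mul1r eE.
rewrite /denergy (le_trans (ler_sum _ (fun i _ => ler_wpM2l (ltW (m_gt0 i))
  (one i))))//.
have -> : \sum_(i < N) m i * (e i + (e i + c * (1 + e i + energy t))) =
   (2 + c) * (\sum_(i < N) m i * e i) + (\sum_(i < N) m i) * (c * (1 + energy t)).
  rewrite mulr_sumr mulr_suml -big_split; apply: eq_bigr => j _ /=.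
  by move: (m j) (e j) (energy t) (c) => *; ring.
rewrite m_sum eE /K mul1r.
have := energy_ge0 t; have D0 : 0 <= d%:R * B ^+ 2 by rewrite mulr_ge0// sqr_ge0.
by rewrite /c; move: (energy t) => En; lra.
Qed.

(** [denergy_le] is a homogeneous inequality for [1 + energy], so multiplying by the integrating
    factor [expR (- (K * s))] gives a nonincreasing function. *)
Lemma energy_gronwall t : 0 <= t -> 1 + energy t <= (1 + energy 0) * expR (K * t).
Proof.
move=> t0.
pose E s := (1 + energy s) * expR (- (K * s)).
suff : E t <= E 0.
  have exp0 : expR (- (K * 0)) = 1 by rewrite mulr0 oppr0 expR0.
  have -> : E 0 = 1 + energy 0 by rewrite /E exp0; exact: mulr1.
  rewrite /E expRN => h.
  by rewrite -ler_pdivrMr ?expR_gt0.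
have dE (s : R) : 0 < s -> is_derive s (1 : R) E
    ((denergy s - K * (1 + energy s)) * expR (- (K * s))).
  move=> s0; have h := has_hderive_is_derive s0 (energy_hderive (ltW s0)).
  have h1 : is_derive s (1 : R) (cst 1 + energy) (0 + denergy s) by apply: is_deriveD.
  have h2 : is_derive s (1 : R) (fun u : R => - (K * u)) (- K).
    have := is_deriveZ (- K) (is_derive_id s (1 : R)).
    rewrite [_ *: 1]mulr1; congr is_derive; apply/funext => u.
    by rewrite /= [_ *: _]mulNr.
  have h3 : is_derive s (1 : R) (expR \o (fun u : R => - (K * u)))
     (expR (- (K * s)) * - K) by apply: is_derive1_comp.
  have -> : E = (cst 1 + energy) * (expR \o (fun u : R => - (K * u))) by [].
  apply: (is_derive_eq (is_deriveM h1 h3)).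
  rewrite /= /cst /= add0r /GRing.scale/= !fctE/=; ring.
have cE : {within halfline, continuous E}.
  have /subspace_continuousP ce := has_hderive_continuous energy_hderive.
  apply/subspace_continuousP => s s0; apply: cvgM.
    by apply: cvgD; [exact: cvg_cst|exact: ce].
  apply: cvg_within_filter; apply: continuous_cvg; first exact: continuous_expR.
  by apply: cvgN; apply: cvgM; [exact: cvg_cst|exact: cvg_id].
apply: (@ler0_derive1_nincr _ E 0 t) => //.
- move=> s; rewrite in_itv/= => /andP[s0 _];
  exact: (@ex_derive _ _ _ _ _ _ _ (dE s s0)).
- move=> s; rewrite in_itv/= => /andP[s0 _]; rewrite derive1E.
  rewrite (@derive_val _ _ _ _ _ _ _ (dE s s0)).
  by rewrite mulr_le0_ge0 ?expR_ge0// subr_le0 denergy_le// ltW.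
- by apply: continuous_subspaceW cE => s /=; rewrite in_itv/= => /andP[].
Qed.

End Newton.

(** * Moments and weak formulation of a particle measure *)

Section ParticleSolution.
Context {R : realType} {d : nat}.
#[local] Existing Instance punctured_filter.
Notation leb := (@lebesgue_measure R).
Context (W : 'rV[R]_d -> R) (B : R).
Hypothesis B0 : 0 <= B.
Hypothesis W_cont : continuous (grad W).
Hypothesis W_growth : forall z, `|grad W z| <= B * (1 + `|z|).
Context (N : nat) (m : 'I_N -> R) (x v : 'I_N -> 'rV[R]_d)
    (gamma : 'I_N -> R -> 'rV[R]_d).
Hypothesis m_gt0 : forall i, 0 < m i.
Hypothesis m_sum : \sum_(i < N) m i = 1.
Hypothesis newton : newton_solution W m x v gamma.
Context (f : R -> Pborel R (phase R d)).
Hypothesis f_particle : forall t, 0 <= t ->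
  is_particle_measure m (fun i => gamma i t) (fun i => hderive (gamma i) t) (f t).

Notation dgamma i := (hderive (gamma i)).
Notation ddgamma i := (hderive (hderive (gamma i))).

Lemma particle_integrable t (g : phase R d -> R) : 0 <= t -> continuous g ->
  (f t).-integrable setT (EFin \o g).
Proof.
move=> t0 cg.
exact: (integrable_atomic m_gt0 (p := fun i => (gamma i t, dgamma i t))
  (f_particle t0) cg).
Qed.

Lemma particle_Rintegral t (g : phase R d -> R) : 0 <= t -> continuous g ->
  \int[f t]_z g z = \sum_(i < N) m i * g (gamma i t, dgamma i t).
Proof.
move=> t0 cg.
exact: (Rintegral_atomic m_gt0 (p := fun i => (gamma i t, dgamma i t))
  (f_particle t0) cg).
Qed.

Lemma particle_weight_integrable t : 0 <= t -> (f t).-integrable setT (EFin \o weight).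
Proof. by move=> t0; apply: particle_integrable => //; exact: weight_continuous. Qed.

Lemma norm_fst_sqr_continuous : continuous (fun z : phase R d => `|z.1| ^+ 2).
Proof.
by move=> z; apply: cvgM; apply: cvg_norm; exact: cvg_fst.
Qed.

Lemma particle_sqr_integrable t : 0 <= t ->
  (f t).-integrable setT (EFin \o (fun z : phase R d => `|z.1| ^+ 2)).
Proof.
by move=> t0; apply: particle_integrable => //; exact: norm_fst_sqr_continuous.
Qed.

Lemma particle_weight_Rintegral_le t : 0 <= t ->
  \int[f t]_z weight z <= 2 + energy m gamma t.
Proof.
move=> t0; rewrite (particle_Rintegral t0 (@weight_continuous R d)).
have -> : 2 + energy m gamma t = \sum_(i < N) m i *
    (2 + (dot (gamma i t) (gamma i t) + dot (dgamma i t) (dgamma i t))).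
  have E2 : 2 = \sum_(i < N) m i * 2 by rewrite -mulr_suml m_sum mul1r.
  by rewrite /energy [in LHS]E2 -big_split; apply: eq_bigr => i _; rewrite [RHS]mulrDr.
apply: ler_sum => i _; rewrite ler_wpM2l ?(ltW (m_gt0 i))// /weight/=.
have amgm (a b p q : R) : a ^+ 2 <= p -> b ^+ 2 <= q -> 1 + a + b <= 2 + (p + q).
  have := sqr_ge0 (1 - a); have := sqr_ge0 (1 - b).
  by have := sqr_ge0 a; have := sqr_ge0 b; rewrite !expr2; lra.
exact: amgm (norm_sqr_le_dot _) (norm_sqr_le_dot _).
Qed.

Lemma particle_sqr_Rintegral_le t : 0 <= t ->
  \int[f t]_z (`|z.1| ^+ 2) <= energy m gamma t.
Proof.
move=> t0; rewrite (particle_Rintegral t0 norm_fst_sqr_continuous).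
apply: ler_sum => i _; rewrite ler_wpM2l ?(ltW (m_gt0 i))//=.
by rewrite (le_trans (norm_sqr_le_dot _))// lerDl dot_ge0.
Qed.

Lemma particle_force_continuous t : 0 <= t ->
  continuous (force W (spatial_marginal (f t))).
Proof.
move=> t0; apply: (force_continuous1 B0 W_cont W_growth).
  exact (particle_weight_integrable t0).
exact (particle_sqr_integrable t0).
Qed.

Lemma particle_force t y : 0 <= t ->
  force W (spatial_marginal (f t)) y = \sum_(j < N) m j *: grad W (y - gamma j t).
Proof.
move=> t0; apply/rowP => i; rewrite (forceE B0 W_cont W_growth
  (particle_weight_integrable t0)).
have [cg _] := grad_shift_linear_growth B0 W_cont W_growth y i.
rewrite (particle_Rintegral t0 cg) summxE.
by apply: eq_bigr => j _; rewrite [RHS]mxE.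
Qed.

Section WeakForm.
Context (phi : phase R d * R -> R).
Hypothesis phi_test : test_function phi.

(** The transport integral with the acceleration in place of minus the force. In this form it is the
    time derivative of the integral of [phi] along the trajectories, and its continuity in [t] is
    visible. *)
Definition particle_action (t : R) : R := \sum_(i < N) m i *
  (Dt phi (gamma i t, dgamma i t, t)
   + dot (dgamma i t) (Dx phi (gamma i t, dgamma i t, t))
   + dot (ddgamma i t) (Dv phi (gamma i t, dgamma i t, t))).

(** Newton's sum runs over all [j], including [j = i], and so does the force of the particle measure
    at one of its own atoms: the two agree with no self-interaction correction. *)
Lemma particle_transport t : 0 <= t ->
  \int[f t]_z transport W f phi t z = particle_action t.
Proof.
move=> t0; rewrite (particle_Rintegral t0); last first.
  by apply: (transport_continuous phi_test t0); exact: particle_force_continuous.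
apply: eq_bigr => i _; congr (_ * _); rewrite /transport/=.
by rewrite (newton_eq W_cont m_gt0 newton i t0) dotNl particle_force.
Qed.

Lemma particle_action_continuous : {within halfline, continuous particle_action}.
Proof.
apply/subspace_continuousP => t t0.
have [_ [cx cv ct] _] := phi_test.
have gt i : gamma i s @[s --> within halfline (nbhs t)] --> gamma i t.
  by apply: cvg_punctured_within; apply: has_hderive_cvg;
    exact: (newton_hderive newton).
have dgt i : dgamma i s @[s --> within halfline (nbhs t)] --> dgamma i t.
  by apply: cvg_punctured_within; apply: has_hderive_cvg;
    exact: (newton_hderive2 newton).
have ddgt i : ddgamma i s @[s --> within halfline (nbhs t)] --> ddgamma i t.
  have [C2 _ _ _] := newton; have [_ _ /subspace_continuousP] := C2 i; exact.
have idt : s @[s --> within halfline (nbhs t)] --> t.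
  by move=> Q hQ; apply: filterS hQ.
have pos : \forall s \near within halfline (nbhs t), 0 <= s by exact: withinT.
have comp (V : normedModType R) (P : phase R d * R -> V) i :
    {within [set p : phase R d * R | 0 <= p.2], continuous P} ->
    P (gamma i s, dgamma i s, s) @[s --> within halfline (nbhs t)] -->
      P (gamma i t, dgamma i t, t).
  move=> cP; apply: (@within_comp_cvg _ _ _ _ _ P
    (fun s => (gamma i s, dgamma i s, s)) (gamma i t, dgamma i t, t) _ cP) => //.
  exact: (cvg_pair (cvg_pair (gt i) (dgt i)) idt).
apply: cvg_sumr => i; apply: cvgM; first exact: cvg_cst.
apply: cvgD; first (apply: cvgD; first exact: comp).
  exact: cvg_dot (dgt i) (comp _ (Dx phi) i cx).
exact: cvg_dot (ddgt i) (comp _ (Dv phi) i cv).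
Qed.

Lemma particle_action_support (r t : R) :
  (forall x v t, 0 <= t -> r < `|x| \/ r < `|v| \/ r < t ->
    [/\ Dx phi (x, v, t) = 0, Dv phi (x, v, t) = 0 & Dt phi (x, v, t) = 0]) ->
  0 <= t -> r < t -> particle_action t = 0.
Proof.
move=> hr t0 rt; apply: big1 => i _.
have [-> -> ->] := hr (gamma i t) (dgamma i t) t t0 (or_intror (or_intror rt)).
by rewrite !dot0r !addr0 mulr0.
Qed.

Lemma particle_weak_form :
  \int[leb]_(t in `[0, +oo[) particle_action t = - \sum_(i < N) m i * phi (x i, v i, 0).
Proof.
have [r r0 hr] := test_derivatives_support phi_test.
have [r' r'0 hr'] := test_function_support phi_test.
pose g s := \sum_(i < N) m i * phi (gamma i s, dgamma i s, s).
(* Beyond both radii: the action vanishes after [T], and the boundary term [g T] is zero. *)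
pose T := r + r' + 1.
have T0 : 0 < T by rewrite /T !addr_gt0.
have dg s : 0 <= s -> has_hderive g s (particle_action s).
  move=> s0; apply: has_hderive_sum => i; apply: has_hderiveZ.
  apply: (@test_chain_rule _ _ _ phi_test (gamma i) (dgamma i) (ddgamma i)) => //.
    exact: (newton_hderive newton).
  exact: (newton_hderive2 newton).
rewrite (Rintegral_halfline T0 dg particle_action_continuous); last first.
  move=> t Tt; apply: (particle_action_support hr); move: Tt; rewrite /T; lra.
have -> : g T = 0.
  apply: big1 => i _; rewrite hr' ?mulr0 ?(ltW T0)//.
  by right; right; rewrite /T; lra.
rewrite sub0r; congr (- _); apply: eq_bigr => i _.
by have [_ _ -> ->] := newton.
Qed.

End WeakForm.

Lemma particle_energy_init (mu : Pborel R (phase R d)) :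
  is_particle_measure m x v mu -> moment2 mu = (energy m gamma 0)%:E.
Proof.
move=> muE; have c2 : continuous (fun z : phase R d => enorm z.1 ^+ 2 + enorm z.2 ^+ 2).
  move=> z.
  have -> : (fun z : phase R d => enorm z.1 ^+ 2 + enorm z.2 ^+ 2) =
    (fun z => dot z.1 z.1 + dot z.2 z.2) by apply/funext => w; rewrite !sqr_enorm.
  by apply: cvgD; apply: cvg_dot;
    [exact: cvg_fst|exact: cvg_fst|exact: cvg_snd|exact: cvg_snd].
have ic2 := integrable_atomic m_gt0 (p := fun i => (x i, v i)) muE c2.
rewrite /moment2 -[LHS]fineK; last exact: integrable_fin_num ic2.
congr EFin; rewrite [LHS](Rintegral_atomic m_gt0 (p := fun i => (x i, v i)) muE c2).
have [_ _ g0 dg0] := newton.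
by apply: eq_bigr => i _; rewrite g0 dg0 /= !sqr_enorm.
Qed.

End ParticleSolution.

(** * The narrow distance *)

Section NarrowDistance.
Context {R : realType} {d : nat}.
Context (h : nat -> phase R d -> R).
Hypothesis h_adm : admissible_narrow_family h.
Implicit Types mu nu lam : Pborel R (phase R d).

Lemma admissible_lipschitz j (z w : phase R d) :
  `|h j z - h j w| <= d%:R * (`|z.1 - w.1| + `|z.2 - w.2|).
Proof.
have [_ lip _] := h_adm; rewrite (le_trans (lip j z w))//.
set a := enorm _; set b := enorm _.
have a0 : 0 <= a by exact: enorm_ge0.
have b0 : 0 <= b by exact: enorm_ge0.
rewrite (@le_trans _ _ (a + b))//; last by rewrite mulrDr lerD// enorm_le_norm.
rewrite -[leRHS]ger0_norm ?addr_ge0// -sqrtr_sqr ler_wsqrtr//.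
by rewrite sqrrD lerD2r lerDl mulrn_wge0// mulr_ge0.
Qed.

Lemma admissible_continuous j : continuous (h j).
Proof.
move=> z; apply/cvgrPdist_le => e e0.
have : d%:R * (`|z.1 - w.1| + `|z.2 - w.2|) @[w --> z] -->
    d%:R * (`|z.1 - z.1| + `|z.2 - z.2|).
  apply: cvgM; first exact: cvg_cst.
  by apply: cvgD; apply: cvg_norm; apply: cvgB;
    [exact: cvg_cst|exact: cvg_fst|exact: cvg_cst|exact: cvg_snd].
rewrite !subrr normr0 addr0 mulr0 => /cvgr0Pnorm_le/(_ _ e0).
apply: filterS => w hw.
by rewrite (le_trans (admissible_lipschitz _ _ _))// (le_trans (ler_norm _)).
Qed.

Definition narrow_term mu nu (j : nat) : R :=
  2^-1 ^+ j.+1 * `|\int[mu]_z h j z - \int[nu]_z h j z|.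

Lemma narrow_distC mu nu : narrow_dist h mu nu = narrow_dist h nu mu.
Proof.
rewrite /narrow_dist; congr (limn (series _)).
by apply/funext => j; rewrite distrC.
Qed.

Lemma narrow_term_ge0 mu nu j : 0 <= narrow_term mu nu j.
Proof. by rewrite mulr_ge0// exprn_ge0. Qed.

Lemma sum_half_powers n : \sum_(0 <= j < n) 2^-1 ^+ j.+1 = 1 - 2^-1 ^+ n :> R.
Proof.
elim: n => [|n IH]; first by rewrite big_nil expr0 subrr.
by rewrite big_nat_recr//= IH exprS; lra.
Qed.

Lemma narrow_series_le mu nu (c : R) n : 0 <= c ->
  (forall j, `|\int[mu]_z h j z - \int[nu]_z h j z| <= c) ->
  series (narrow_term mu nu) n <= c.
Proof.
move=> c0 hc; rewrite (@le_trans _ _ (\sum_(0 <= j < n) 2^-1 ^+ j.+1 * c))//.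
  by apply: ler_sum => j _; rewrite ler_wpM2l// exprn_ge0.
by rewrite -mulr_suml sum_half_powers ler_piMl// gerBl exprn_ge0.
Qed.

Lemma narrow_diff_le mu nu j : `|\int[mu]_z h j z - \int[nu]_z h j z| <= 2.
Proof.
have [h1 _ _] := h_adm.
have cj := @admissible_continuous j.
have bmu := normr_Rintegral_bounded mu cj (h1 j).
have bnu := normr_Rintegral_bounded nu cj (h1 j).
by rewrite (le_trans (ler_normB _ _))//; lra.
Qed.

(** [narrow_dist] is a [limn], which can be estimated only once the series is known to converge. Its
    terms are nonnegative and its partial sums at most 2. *)
Lemma narrow_series_cvg mu nu : cvgn (series (narrow_term mu nu)).
Proof.
apply: nondecreasing_is_cvgn.
  by apply/nondecreasing_seqP => n; rewrite /series/= big_nat_recr//= lerDl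
    narrow_term_ge0.
by exists 2 => _ [n _ <-]; apply: narrow_series_le => // j; exact: narrow_diff_le.
Qed.

Lemma narrow_dist_le mu nu (c : R) : 0 <= c ->
  (forall j, `|\int[mu]_z h j z - \int[nu]_z h j z| <= c) ->
  narrow_dist h mu nu <= c.
Proof.
move=> c0 hc; apply: limr_le; first exact: narrow_series_cvg.
by apply: nearW => n; exact: narrow_series_le.
Qed.

Lemma narrow_dist_triangle lam mu nu :
  narrow_dist h mu nu <= narrow_dist h mu lam + narrow_dist h lam nu.
Proof.
have cs := cvgD (@narrow_series_cvg mu lam) (@narrow_series_cvg lam nu).
have {}cs := cs eventually_filter.
rewrite -[leRHS](cvg_lim _ cs)//.
apply: ler_lim; [exact: narrow_series_cvg|exact: cvgP cs|].
apply: nearW => n; rewrite fctE /series/= -big_split; apply: ler_sum => j _.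
rewrite /narrow_term/= -mulrDr ler_wpM2l ?exprn_ge0//.
exact: ler_distD.
Qed.

(** The masses stay fixed while the atoms move, so each [h j], being Lipschitz, changes its integral
    by at most the weighted displacement [D s], which does not depend on [j]. *)
Lemma particle_narrow_continuous (N : nat) (m : 'I_N -> R) (x v : 'I_N -> R -> 'rV[R]_d)
    (f : R -> Pborel R (phase R d)) :
  (forall i, 0 < m i) ->
  (forall t, 0 <= t -> is_particle_measure m (x^~ t) (v^~ t) (f t)) ->
  (forall i, {within halfline, continuous (x i)}) ->
  (forall i, {within halfline, continuous (v i)}) ->
  forall t e : R, 0 <= t -> 0 < e ->
    \forall s \near within halfline (nbhs t), narrow_dist h (f t) (f s) <= e.
Proof.
move=> m0 fE cx cv t e t0 e0.
pose D s := \sum_(i < N) m i * (d%:R * (`|x i t - x i s| + `|v i t - v i s|)).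
have D0 : D s @[s --> within halfline (nbhs t)] -->
    \sum_(i < N) m i * (d%:R * (`|x i t - x i t| + `|v i t - v i t|)).
  apply: cvg_sumr => i; apply: cvgM; first exact: cvg_cst.
  apply: cvgM; first exact: cvg_cst.
  apply: cvgD; apply: cvg_norm; (apply: cvgB; first exact: cvg_cst).
    by move/subspace_continuousP : (cx i); exact.
  by move/subspace_continuousP : (cv i); exact.
have {}D0 : D s @[s --> within halfline (nbhs t)] --> 0.
  move: D0; rewrite big1 // => i _; by rewrite !subrr normr0 addr0 !mulr0.
have pos : \forall s \near within halfline (nbhs t), 0 <= s by exact: withinT.
move/cvgr0Pnorm_le : D0 => /(_ _ e0).
apply: filterS2 pos => s s0 hs; rewrite (le_trans _ hs)// (le_trans _ (ler_norm _))//.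
apply: narrow_dist_le.
  by apply: sumr_ge0 => i _; rewrite !mulr_ge0 ?(ltW (m0 i))// addr_ge0.
move=> j; have cj := @admissible_continuous j.
rewrite (Rintegral_atomic m0 (p := fun i => (x i t, v i t)) (fE t t0) cj).
rewrite (Rintegral_atomic m0 (p := fun i => (x i s, v i s)) (fE s s0) cj).
rewrite -sumrB (le_trans (ler_norm_sum _ _ _))//; apply: ler_sum => i _.
rewrite -mulrBr normrM (gtr0_norm (m0 i)) ler_wpM2l ?(ltW (m0 i))//.
exact: (admissible_lipschitz j (x i t, v i t) (x i s, v i s)).
Qed.

(** A uniform limit of continuous curves: one index [j] is within [e / 4] of [f] on all of
    [[0, t + 1]], and three such errors stay strictly below [e]. That [h] metrizes the narrow
    topology turns this into continuity into [narrow_space]. *)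
Lemma narrow_uniform_limit_continuous (f_ : nat -> R -> Pborel R (phase R d))
    (f : R -> Pborel R (phase R d)) :
  (forall j (t e : R), 0 <= t -> 0 < e ->
    \forall s \near within halfline (nbhs t), narrow_dist h (f_ j t) (f_ j s) <= e) ->
  cvg_locally_uniformly h f_ f ->
  {within [set t : R | 0 <= t], continuous (f : R -> narrow_space R (phase R d))}.
Proof.
move=> f_cont unif; apply/subspace_continuousP => t t0 A.
have [_ _ metr] := h_adm; rewrite (metr (f t)) => -[e /= e0 eA].
have e40 : 0 < e / 4 by rewrite divr_gt0.
have e4e : e / 4 + (e / 4 + e / 4) < e by lra.
have t1 : 0 <= t + 1 by rewrite addr_ge0.
have [j _ /(_ j (leqnn j)) hj] := unif 0 (t + 1) (lexx _) t1 (e / 4) e40.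
have st : \forall s \near within halfline (nbhs t), s <= t + 1.
  have tt1 : t < t + 1 by rewrite ltrDl.
  have H : \forall s \near t, s <= t + 1.
    by apply: filterS (lt_nbhsl tt1) => s /ltW.
  have H' : nbhs t [set s : R | 0 <= s -> s <= t + 1] by apply: filterS H => s hs _.
  exact: H'.
have pos : \forall s \near within halfline (nbhs t), 0 <= s by exact: withinT.
suff : \forall s \near within halfline (nbhs t), A (f s) by [].
have fc := f_cont j t _ t0 e40.
near=> s; apply: (eA (f s)) => /=.
have s0 : 0 <= s by near: s.
have st1 : s <= t + 1 by near: s.
have h1 : narrow_dist h (f t) (f_ j t) < e / 4.
  by rewrite narrow_distC; apply: hj; rewrite in_itv/= (t0 : 0 <= t) lerDl ler01.
have h2 : narrow_dist h (f_ j s) (f s) < e / 4.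
  by apply: hj; rewrite in_itv/= s0 st1.
have h3 : narrow_dist h (f_ j t) (f_ j s) <= e / 4.
  by near: s.
have h4 := narrow_dist_triangle (f_ j t) (f t) (f s).
have h5 := narrow_dist_triangle (f_ j s) (f_ j t) (f s).
rewrite (le_lt_trans h4)// (@lt_trans _ _ (e / 4 + (e / 4 + e / 4)))//.
exact: ltrD h1 (le_lt_trans h5 (ler_ltD h3 h2)).
Unshelve. all: by end_near. Qed.

End NarrowDistance.

(** * Bounds that no longer mention the particles *)

Section ParticleSolutions.
Context {R : realType} {d : nat}.
Notation leb := (@lebesgue_measure R).
Context (W : 'rV[R]_d -> R) (B : R).
Hypothesis B0 : 0 <= B.
Hypothesis W_cont : continuous (grad W).
Hypothesis W_growth : forall z, `|grad W z| <= B * (1 + `|z|).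

(** Hides the number of particles, the masses and the trajectories, which vary along the sequence;
    only the initial measure and the curve remain. *)
Definition particle_solution (mu : Pborel R (phase R d))
    (f : R -> Pborel R (phase R d)) :=
  exists (N : nat) (m : 'I_N -> R) (x v : 'I_N -> 'rV[R]_d)
    (gamma : 'I_N -> R -> 'rV[R]_d),
  [/\ forall i, 0 < m i, \sum_(i < N) m i = 1, is_particle_measure m x v mu,
      newton_solution W m x v gamma &
      forall t, 0 <= t -> is_particle_measure m (fun i => gamma i t)
        (fun i => hderive (gamma i) t) (f t)].

Context (mu : Pborel R (phase R d)) (f : R -> Pborel R (phase R d)).
Hypothesis f_sol : particle_solution mu f.

Lemma solution_integrable t (g : phase R d -> R) : 0 <= t -> continuous g ->
  (f t).-integrable setT (EFin \o g).
Proof.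
have [N [m [x [v [gamma [m0 m1 muE newton fE]]]]]] := f_sol.
exact: (particle_integrable m0 fE).
Qed.

(** The exponential term is Gronwall's bound for initial second moment [e]; the 2 comes from
    [weight z <= 2 + |x|^2 + |v|^2]. *)
Definition moment_bound (e t : R) : R :=
  2 + (1 + e) * expR ((2 + 6 * d%:R * B ^+ 2) * t).

Lemma moment_bound_ge0 (e t : R) : 0 <= e -> 0 <= moment_bound e t.
Proof. by move=> e0; rewrite addr_ge0// mulr_ge0 ?expR_ge0// addr_ge0. Qed.

Lemma moment_bound_le (e e' s t : R) : 0 <= e -> e <= e' -> s <= t ->
  moment_bound e s <= moment_bound e' t.
Proof.
move=> e0 ee' st; rewrite lerD2l ler_pM ?expR_ge0 ?addr_ge0 ?lerD2l//.
rewrite ler_expR ler_wpM2l// addr_ge0// !mulr_ge0// sqr_ge0.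
Qed.

Lemma solution_moments : exists2 e : R, 0 <= e & moment2 mu = e%:E /\
  forall t, 0 <= t -> \int[f t]_z weight z <= moment_bound e t /\
    \int[f t]_z (`|z.1| ^+ 2) <= moment_bound e t.
Proof.
have [N [m [x [v [gamma [m0 m1 muE newton fE]]]]]] := f_sol.
exists (energy m gamma 0); first exact: energy_ge0.
split; first exact: (particle_energy_init m0 newton muE).
move=> t t0; have e0 := energy_ge0 gamma m0 t.
have gw := energy_gronwall B0 W_cont W_growth m0 m1 newton t0.
split.
  rewrite (le_trans (particle_weight_Rintegral_le m0 m1 fE t0))// lerD2l.
  by rewrite (le_trans _ gw)// lerDr.
rewrite (le_trans (particle_sqr_Rintegral_le m0 fE t0))//.
by rewrite (@le_trans _ _ (1 + energy m gamma t)) ?lerDr// (le_trans gw)// lerDr.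
Qed.

Lemma solution_init (g : phase R d -> R) : continuous g ->
  \int[f 0]_z g z = \int[mu]_z g z.
Proof.
have [N [m [x [v [gamma [m0 m1 muE newton fE]]]]]] := f_sol => cg.
rewrite (particle_Rintegral m0 fE (lexx _) cg).
rewrite (Rintegral_atomic m0 (p := fun i => (x i, v i)) muE cg).
by have [_ _ g0 dg0] := newton; apply: eq_bigr => i _; rewrite g0 dg0.
Qed.

Lemma solution_narrow_continuous (h : nat -> phase R d -> R) :
  admissible_narrow_family h -> forall t e : R, 0 <= t -> 0 < e ->
  \forall s \near within halfline (nbhs t), narrow_dist h (f t) (f s) <= e.
Proof.
have [N [m [x [v [gamma [m0 m1 muE newton fE]]]]]] := f_sol => hh.
apply: (particle_narrow_continuous hh m0 fE) => i.
  by apply: has_hderive_continuous => t; exact: (newton_hderive newton).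
by apply: has_hderive_continuous => t; exact: (newton_hderive2 newton).
Qed.

(** Measurability in time is recorded for dominated convergence. It comes from [particle_action],
    which agrees with [S] on the half-line and is continuous there. *)
Lemma solution_weak_form (phi : phase R d * R -> R) : test_function phi ->
  let S t := \int[f t]_z transport W f phi t z in
  measurable_fun (`[0, +oo[%classic : set R) S /\
  \int[leb]_(t in `[0, +oo[) S t = - \int[mu]_z phi (z, 0).
Proof.
move=> phi_test S.
have [N [m [x [v [gamma [m0 m1 muE newton fE]]]]]] := f_sol.
have SE : {in `[0, +oo[%classic, S =1 particle_action m gamma phi}.
  move=> t; rewrite inE/= in_itv/= andbT => t0.
  exact: (particle_transport B0 W_cont W_growth m0 newton fE phi_test t0).
split.
  apply: (eq_measurable_fun (particle_action m gamma phi)) => [t tI|].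
    by rewrite SE.
  have := particle_action_continuous newton phi_test.
  have -> : halfline = `[0, +oo[%classic :> set R.
    by apply/seteqP; split => t; rewrite /halfline/= in_itv/= andbT.
  by apply: subspace_continuous_measurable_fun; exact: measurable_itv.
have [c0 _] := test_init_bounded_continuous phi_test.
transitivity (\int[leb]_(t in `[0, +oo[) particle_action m gamma phi t).
  by apply: eq_Rintegral => t; exact: SE.
rewrite (particle_weak_form newton phi_test).
by rewrite (Rintegral_atomic m0 (p := fun i => (x i, v i)) muE c0).
Qed.

End ParticleSolutions.

(** * Passage to the limit *)

(** Passage from Euclidean to sup norms: [1 + enorm z <= 1 + d * |z| <= (1 + d) * (1 + |z|)]. *)
Lemma grad_linear_growth {R : realType} {d : nat} (W : 'rV[R]_d -> R) :
  has_ubound (range (fun z : 'rV[R]_d => enorm (grad W z) / (1 + enorm z))) ->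
  exists2 B : R, 0 <= B & forall z, `|grad W z| <= B * (1 + `|z|).
Proof.
move=> [c hc]; exists (`|c| * (1 + d%:R)) => [|z]; first by rewrite mulr_ge0 ?addr_ge0.
have e0 := enorm_ge0 z; have e1 : 0 < 1 + enorm z by rewrite ltr_wpDr.
have : enorm (grad W z) / (1 + enorm z) <= c by apply: hc; exists z.
rewrite ler_pdivrMr// => h; rewrite (le_trans (norm_le_enorm _))// (le_trans h)//.
rewrite (@le_trans _ _ (`|c| * (1 + enorm z)))//.
  by rewrite ler_wpM2r ?ler_norm// ltW.
rewrite -mulrA ler_wpM2l//.
have ed := enorm_le_norm z; have d0 : 0 <= d%:R :> R by [].
by have := normr_ge0 z; rewrite mulrDl mul1r mulrDr mulr1; lra.
Qed.

Lemma linear_growth_ubound {R : realType} {d : nat} (g : phase R d -> R) :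
  linear_growth g ->
  has_ubound (range (fun z : phase R d => `|g z| / (1 + enorm z.1 + enorm z.2))).
Proof.
move=> [_ [C hC]]; exists `|C| => _ [z _ <-].
have e1 := enorm_ge0 z.1; have e2 := enorm_ge0 z.2.
rewrite ler_pdivrMr; last by rewrite -addrA ltr_wpDr// addr_ge0.
rewrite (le_trans (hC z))// (@le_trans _ _ (`|C| * weight z))//.
  by rewrite ler_wpM2r ?ler_norm// (le_trans ler01)// weight_ge1.
by rewrite ler_wpM2l// lerD ?norm_le_enorm// lerD2l norm_le_enorm.
Qed.

Section MainLimit.
Context {R : realType} {d : nat}.
Notation leb := (@lebesgue_measure R).
Context (W : 'rV[R]_d -> R) (B : R).
Hypothesis B0 : 0 <= B.
Hypothesis W_cont : continuous (grad W).
Hypothesis W_growth : forall z, `|grad W z| <= B * (1 + `|z|).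
Context (f0 : Pborel R (phase R d)) (mu_ : nat -> Pborel R (phase R d)).
Context (f_ : nat -> R -> Pborel R (phase R d)) (f : R -> Pborel R (phase R d)).
Hypothesis f__sol : forall n, particle_solution W (mu_ n) (f_ n).
Hypothesis mu__cvg : narrow_cvg mu_ f0.
Context (E : R).
Hypothesis E0 : 0 <= E.
Hypothesis moments : forall n, (moment2 (mu_ n) <= E%:E)%E.
Hypothesis f_lin : forall t : R, 0 <= t -> forall g, linear_growth g ->
  (\int[f_ n t]_z (g z)%:E)%E @[n --> \oo] --> (\int[f t]_z (g z)%:E)%E.

Notation bound := (moment_bound (d := d) B E).

Lemma uniform_moments n t : 0 <= t ->
  \int[f_ n t]_z weight z <= bound t /\ \int[f_ n t]_z (`|z.1| ^+ 2) <= bound t.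
Proof.
move=> t0; have [e e0 [eE /(_ t t0) [h1 h2]]] := solution_moments B0 W_cont W_growth
  (f__sol n).
have eEE : e <= E by have := moments n; rewrite eE lee_fin.
have le_b := moment_bound_le (d := d) B0 e0 eEE (lexx t).
by split; [exact: le_trans h1 le_b|exact: le_trans h2 le_b].
Qed.

Lemma approx_weight_integrable n t : 0 <= t ->
    (f_ n t).-integrable setT (EFin \o weight).
Proof.
by move=> t0; apply: (solution_integrable (f__sol n) t0); exact: weight_continuous.
Qed.

Lemma approx_sqr_integrable n t : 0 <= t ->
  (f_ n t).-integrable setT (EFin \o (fun z : phase R d => `|z.1| ^+ 2)).
Proof.
by move=> t0; apply: (solution_integrable (f__sol n) t0);
  exact: norm_fst_sqr_continuous.
Qed.

Lemma weight_linear_growth : linear_growth (@weight R d).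
Proof.
split; first exact: weight_continuous.
by exists 1 => z; rewrite mul1r ger0_norm// (le_trans ler01)// weight_ge1.
Qed.

(** The convergence [f_lin] is between extended real integrals, so the uniform bound on the
    integrals of [weight] passes to the limit and forces it to be finite. *)
Lemma limit_weight_integrable t : 0 <= t -> (f t).-integrable setT (EFin \o weight).
Proof.
move=> t0; apply/integrableP; split.
  by apply/measurable_EFinP; apply: continuous_borel_measurable;
    exact: weight_continuous.
have -> : (\int[f t]_z `|(EFin \o weight) z| = \int[f t]_z (weight z)%:E)%E.
  by apply: eq_integral => z _ /=; rewrite ger0_norm// (le_trans ler01)// weight_ge1.
rewrite (@le_lt_trans _ _ (bound t)%:E)// ?ltry//.
have cw := f_lin t0 weight_linear_growth.
rewrite -(cvg_lim _ cw)//; apply: lime_le; first exact: cvgP cw.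
apply: nearW => n; rewrite -[leLHS]fineK; last first.
  by apply: integrable_fin_num => //; exact (approx_weight_integrable n t0).
by rewrite lee_fin; have [] := uniform_moments n t0.
Qed.

Lemma limit_cvg t : 0 <= t -> forall g, linear_growth g ->
  \int[f_ n t]_z g z @[n --> \oo] --> \int[f t]_z g z.
Proof.
move=> t0 g lg; apply: fine_cvg; rewrite fineK; first exact: f_lin.
by apply: integrable_fin_num => //; exact: (linear_growth_integrable
  (limit_weight_integrable t0) lg).
Qed.

(** At time 0 the particle measures integrate continuous functions as [mu_ n] does, so [f 0] and
    [f0] are limits of the same integrals of bounded continuous functions. *)
Lemma limit_initial : eq_borel (f 0) f0.
Proof.
apply: bounded_continuous_measure_eq => g bg; have [cg [M gM]] := bg.
have lg := bounded_linear_growth cg gM.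
have h1 := limit_cvg (lexx 0) lg.
have h2 : \int[f_ n 0]_z g z @[n --> \oo] --> \int[f0]_z g z.
  apply: cvg_trans (mu__cvg bg); apply: near_eq_cvg; apply: nearW => n.
  exact: esym (solution_init (f__sol n) cg).
exact: (cvg_unique _ h1 h2).
Qed.

Lemma limit_sqr_near t : 0 <= t ->
  \forall n \near \oo, \int[f_ n t]_z (`|z.1| ^+ 2) <= bound t.
Proof. by move=> t0; apply: nearW => n; have [] := uniform_moments n t0. Qed.

Section WeakForm.
Context (phi : phase R d * R -> R).
Hypothesis phi_test : test_function phi.

Lemma limit_transport_integrable t : 0 <= t ->
  (f t).-integrable setT (EFin \o transport W f phi t).
Proof.
move=> t0; have [C C0 hC] := transport_bounded B0 W_cont W_growth phi_test.
apply: (@bounded_integrable _ _ _ _ (C * (1 + \int[f t]_w `|w.1|))).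
  apply: (transport_continuous phi_test t0).
  apply: (@limit_force_continuous _ _ _ _ B0 W_cont W_growth f_ f t (bound t)) => //.
  - by move=> n; exact (approx_weight_integrable n t0).
  - by move=> n; exact (approx_sqr_integrable n t0).
  - exact (limit_weight_integrable t0).
  - exact: moment_bound_ge0.
  - exact: limit_sqr_near.
  - exact: limit_cvg.
exact: hC (limit_weight_integrable t0).
Qed.

Lemma limit_transport_cvg t : 0 <= t ->
  \int[f_ n t]_z transport W (f_ n) phi t z @[n --> \oo] -->
  \int[f t]_z transport W f phi t z.
Proof.
move=> t0.
apply: (@transport_cvg _ _ _ _ B0 W_cont W_growth phi phi_test f_ f t (bound t)) => //.
- by move=> n; exact (approx_weight_integrable n t0).
- by move=> n; exact (approx_sqr_integrable n t0).
- exact (limit_weight_integrable t0).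
- exact: moment_bound_ge0.
- exact: limit_sqr_near.
- exact: limit_cvg.
Qed.

Lemma approx_transport_dominated : exists2 G : R -> R,
  leb.-integrable `[0, +oo[ (EFin \o G) &
  forall n t, 0 <= t -> `|\int[f_ n t]_z transport W (f_ n) phi t z| <= G t.
Proof.
have [C C0 hC] := transport_bounded B0 W_cont W_growth phi_test.
have [r r0 hr] := test_derivatives_support phi_test.
(* The transport integral vanishes after time [r], and before it the moment bound, nondecreasing in
   time, is at most [bound r]. *)
pose c := C * (1 + bound r).
have br0 : 0 <= bound r by exact: moment_bound_ge0.
exists (fun t => c * \1_(`[0, r]%classic) t).
  have i1 := @integrable_indic_itv R 0 r true false.
  have i2 : leb.-integrable setT (EFin \o (fun t => c * \1_(`[0, r]%classic) t)).
    exact (integrableZl measurableT c i1).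
  by apply: (integrableS _ _ _ i2) => //; exact: measurable_itv.
move=> n t t0; have iw := approx_weight_integrable n t0.
have [tr|tr] := leP t r; last first.
  have -> : \int[f_ n t]_z transport W (f_ n) phi t z = 0.
    rewrite -[RHS](Rintegral_prob_cst (f_ n t)); apply: eq_Rintegral => -[x v] _.
    have [hx hv ht] := hr x v t t0 (or_intror (or_intror tr)).
    by rewrite /transport hx hv ht/= !dot0r addr0 subrr.
  by rewrite normr0 mulr_ge0// mulr_ge0// addr_ge0.
have -> : \1_(`[0, r]%classic) t = 1 :> R.
  by rewrite indicE mem_set//= in_itv/= t0.
rewrite mulr1 (@le_trans _ _ (C * (1 + \int[f_ n t]_w `|w.1|)))//.
  apply: normr_Rintegral_bounded; last exact: hC iw.
  apply: (transport_continuous phi_test t0).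
  exact: (force_continuous1 B0 W_cont W_growth iw (approx_sqr_integrable n t0)).
rewrite ler_wpM2l// lerD2l.
have [h1 _] := uniform_moments n t0.
rewrite (@le_trans _ _ (bound t))//; last exact: moment_bound_le.
rewrite (le_trans _ h1)//; apply: le_Rintegral => //.
  exact (norm_fst_integrable iw).
by move=> z _; rewrite /weight; have := normr_ge0 z.2; lra.
Qed.

Lemma limit_weak_form :
  leb.-integrable `[0, +oo[ (fun t => (\int[f t]_z transport W f phi t z)%:E) /\
  \int[leb]_(t in `[0, +oo[) (\int[f t]_z transport W f phi t z) + \int[f0]_z phi
    (z, 0) = 0.
Proof.
pose S_ n t := \int[f_ n t]_z transport W (f_ n) phi t z.
pose S t := \int[f t]_z transport W f phi t z.
pose D : set R := `[0, +oo[%classic.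
have mI : measurable D by exact: measurable_itv.
have [G iG hG] := approx_transport_dominated.
have wf n := solution_weak_form B0 W_cont W_growth (f__sol n) phi_test.
have mS_ n : measurable_fun (`[0, +oo[%classic : set R) (S_ n) by have [] := wf n.
have S_S t : `[0, +oo[%classic t -> S_ n t @[n --> \oo] --> S t.
  by rewrite /= in_itv/= andbT; exact: limit_transport_cvg.
(* Nothing is known about the regularity of [S] in time; it is measurable as a pointwise limit. *)
have mS : measurable_fun (`[0, +oo[%classic : set R) S by exact: measurable_fun_cvg
    mS_ S_S.
have [iS _ cS] : [/\ leb.-integrable D (EFin \o S),
    [sequence (\int[leb]_(t in D) `|(S_ n t)%:E - (S t)%:E|)%E]_n @ \oo --> 0%E &
    [sequence (\int[leb]_(t in D) (S_ n t)%:E)%E]_n @ \oo -->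
      (\int[leb]_(t in D) (S t)%:E)%E].
  apply: (@dominated_convergence _ _ _ leb _ mI (fun n t => (S_ n t)%:E) (EFin \o S)
    (EFin \o G)) => //.
  - by move=> n; apply/measurable_EFinP; exact: mS_.
  - by apply/measurable_EFinP; exact: mS.
  - by apply: aeW => t tI; apply: cvg_EFin; [exact: nearW|exact: S_S].
  - by apply: aeW => t n; rewrite /D/= in_itv/= andbT => t0; rewrite lee_fin hG.
split; first exact: iS.
have cS' : \int[leb]_(t in `[0, +oo[) S_ n t @[n --> \oo] -->
    \int[leb]_(t in `[0, +oo[) S t.
  by apply: fine_cvg; rewrite fineK//; exact: integrable_fin_num iS.
have c0 : \int[mu_ n]_z phi (z, 0) @[n --> \oo] --> \int[f0]_z phi (z, 0).
  by apply: mu__cvg; exact: test_init_bounded_continuous.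
have csum : \int[leb]_(t in `[0, +oo[) S_ n t + \int[mu_ n]_z phi (z, 0) @[n --> \oo]
    -->
    \int[leb]_(t in `[0, +oo[) S t + \int[f0]_z phi (z, 0) by exact: cvgD.
(* The approximating sums are all zero by the weak form for particles, hence so is their limit. *)
apply: (cvg_unique _ csum) => //.
apply: cvg_near_cst; apply: nearW => n.
by have [_ ->] := wf n; rewrite addNr.
Qed.

End WeakForm.

End MainLimit.

Theorem theorem3p8 (R : realType) (d : nat)
  (h : nat -> phase R d -> R) (hh : admissible_narrow_family h)
  (W : 'rV[R]_d -> R)
  (W_C1 : C1 W)
  (W_even : forall z, W (- z) = W z)
  (W_semiconvex : exists L : R, 0 <= L /\
     convex_function setT
       (fun z : 'rV[R]_d => W z + L / 2 * enorm z ^+ 2))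
  (W_growth : has_ubound
     (range (fun z : 'rV[R]_d => enorm (grad W z) / (1 + enorm z))))
  (f0 : Pborel R (phase R d))
  (f0_moment : (moment2 f0 < +oo)%E)
  (fk : nat -> R -> Pborel R (phase R d))
  (fk_approx : approximating_sequence W f0 fk)
  (f : R -> Pborel R (phase R d))
  (kj : nat -> nat)
  (kj_incr : {homo kj : i j / (i < j)%N})
  (f_unif : cvg_locally_uniformly h (fun j => fk (kj j)) f)
  (f_lin : forall t : R, 0 <= t ->
     forall phi : phase R d -> R, continuous phi ->
     has_ubound (range (fun z : phase R d =>
       `|phi z| / (1 + enorm z.1 + enorm z.2))) ->
     (\int[fk (kj j) t]_z (phi z)%:E)%E @[j --> \oo] -->
     (\int[f t]_z (phi z)%:E)%E) :
  weak_solution W f0 f /\ eq_borel (f 0) f0.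
Proof.
have [B B0 W_B] := grad_linear_growth W_growth.
have [_ W_cont] := W_C1.
have [f0k [f0k_cvg f0k_moment f0k_part]] := fk_approx.
(* Serves twice: [kj] tends to infinity, and shifting its argument by [n0] puts its values beyond
   [n0]. *)
have kj_ge n : (n <= kj n)%N.
  by elim: n => // n IH; rewrite (leq_ltn_trans IH)// kj_incr.
have kj_cvg : kj n @[n --> \oo] --> \oo.
  move=> A [n0 _ n0A]; exists n0 => // n /= n0n; apply: n0A => /=.
  exact: leq_trans n0n (kj_ge n).
have sol k : particle_solution W (f0k k) (fk k).
  have [N [m [x [v [gamma [m0 m1 muE newton fE]]]]]] := f0k_part k.
  by exists N, m, x, v, gamma.
have moment_ge0 : (0 <= moment2 f0)%E.
  by apply: integral_ge0 => z _; rewrite lee_fin addr_ge0// sqr_ge0.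
(* Strictly above the limit of the initial second moments, so these lie below [E] from some index
   on. *)
pose E := fine (moment2 f0) + 1.
have E0 : 0 <= E by rewrite addr_ge0// fine_ge0.
have [n0 _ hn0] : nbhs \oo [set k | (moment2 (f0k k) <= E%:E)%E].
  have mE : moment2 f0 = (fine (moment2 f0))%:E by rewrite fineK// ge0_fin_numE.
  have lt_E : (moment2 f0 < E%:E)%E by rewrite mE lte_fin ltrDl.
  have H : nbhs (moment2 f0) [set y | (y < E%:E)%E] by exact: open_ereal_lt'.
  have H' : nbhs \oo [set k | (moment2 (f0k k) < E%:E)%E] := f0k_moment _ H.
  by apply: filterS H' => k /ltW.
(* The first n0 indices are dropped so that the moment bound, hence the
   dominating function in time, serves all n. *)
pose k n := kj (n + n0).
have k_cvg : k n @[n --> \oo] --> \oo by apply: cvg_comp kj_cvg; exact: cvg_addnr.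
have k_moment n : (moment2 (f0k (k n)) <= E%:E)%E.
  by apply: hn0; rewrite /= (leq_trans (leq_addl n n0))// kj_ge.
have k_narrow : narrow_cvg (fun n => f0k (k n)) f0.
  by move=> g bg; exact: (cvg_comp _ _ k_cvg (f0k_cvg g bg)).
have k_lin t : 0 <= t -> forall g, linear_growth g ->
    (\int[fk (k n) t]_z (g z)%:E)%E @[n --> \oo] --> (\int[f t]_z (g z)%:E)%E.
  move=> t0 g lg; have [cg _] := lg.
  have := f_lin t t0 g cg (linear_growth_ubound lg).
  by apply: cvg_comp; exact: cvg_addnr.
have k_sol n := sol (k n).
split; last exact: (limit_initial B0 W_cont W_B k_sol k_narrow k_moment k_lin).
split.
- apply: (narrow_uniform_limit_continuous hh _ f_unif) => j.
  exact: (solution_narrow_continuous (sol (kj j)) hh).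
- move=> t t0 x i; apply: (marginal_integrable B0 W_cont W_B).
  exact (limit_weight_integrable B0 W_cont W_B k_sol k_moment k_lin t0).
- move=> phi phi_test.
  have [iS weak] := limit_weak_form B0 W_cont W_B k_sol k_narrow E0 k_moment k_lin
      phi_test.
  split => // t t0.
  exact (limit_transport_integrable B0 W_cont W_B k_sol E0 k_moment k_lin phi_test t0).
Qed.
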